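(* Let $m>0$ and $1<p<\infty$. Let $u\in\mathcal{L}_0(\mathbb{R}^N)$ be a nonnegative Dini continuous solution of $$(\mathcal{I}-\Delta)^{\log}u(x)+m\,u(x)=u^{p}(x),\qquad x\in\mathbb{R}^N .$$ If $$\lim_{|x|\to\infty}u(x)=a<\left(\frac{m}{p}\right)^{\frac{1}{p-1}},$$ then $u$ must be radially symmetric and monotone decreasing about some point in $\mathbb{R}^N$; that is, there exist $x_0\in\mathbb{R}^N$ and a nonincreasing function $g:[0,\infty)\to[0,\infty)$ such that $u(x)=g(|x-x_0|)$ for all $x\in\mathbb{R}^N$.
   Context: $N\ge 1$ is an integer. The logarithmic Schrödinger operator (the operator with Fourier symbol $\log(1+|\xi|^2)$) is the singular integral operator $$(\mathcal{I}-\Delta)^{\log}u(x)=c_N\,P.V.\int_{\mathbb{R}^N}\frac{u(x)-u(y)}{|x-y|^N}\,\kappa(|x-y|)\,dy,$$ where $c_N=\pi^{-N/2}$, $\kappa(r)=2^{1-\frac N2}r^{\frac N2}\mathcal{K}_{\frac N2}(r)$ for $r>0$, and $P.V.$ is the Cauchy principal value (the limit as $\epsilon\to0^+$ of the integral over $\{|x-y|>\epsilon\}$). Here $\mathcal{K}_\nu$ is the modified Bessel function of the second kind with index $\nu>0$, $$\mathcal{K}_\nu(r)=\frac{(\pi/2)^{1/2}r^\nu e^{-r}}{\Gamma(\nu+\frac12)}\int_0^\infty\Big(1+\frac t2\Big)^{\nu-\frac12}e^{-rt}t^{\nu-\frac12}\,dt .$$ $\mathcal{L}_0(\mathbb{R}^N)$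 is the space of locally integrable functions $u:\mathbb{R}^N\to\mathbb{R}$ with $$\|u\|_{\mathcal{L}_0(\mathbb{R}^N)}=\int_{\mathbb{R}^N}\frac{|u(x)|e^{-|x|}}{(1+|x|)^{\frac{N+1}{2}}}\,dx<\infty .$$ For a measurable set $U\subset\mathbb{R}^N$ and a measurable $u:U\to\mathbb{R}$, the modulus of continuity of $u$ at $x\in U$ is $\Psi_{u,x,U}(r)=\sup_{y\in U,\,|x-y|\le r}|u(x)-u(y)|$, and $u$ is Dini continuous at $x$ if $\int_0^1\frac{\Psi_{u,x,U}(r)}{r}\,dr<\infty$. A function is Dini continuous if this holds at every point of its domain (here $U=\mathbb{R}^N$). For bounded $u\in\mathcal{L}_0(\mathbb{R}^N)$ that is Dini continuous at $x$, the quantity $(\mathcal{I}-\Delta)^{\log}u(x)$ is well defined by the formula $(\mathcal{I}-\Delta)^{\log}u(x)=c_N\,P.V.\int_{\mathbb{R}^N}\frac{u(x)-u(y)}{|x-y|^N}\,\kappa(|x-y|)\,dy$; the equation $(\mathcal{I}-\Delta)^{\log}u(x)+m\,u(x)=u^{p}(x)$ is understood pointwise. *)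

(* Defs.v *)
From HB Require Import structures.
From mathcomp Require Import all_boot all_order all_algebra.
From mathcomp Require Import all_classical all_reals all_analysis.
Set Implicit Arguments.
Unset Strict Implicit.
Unset Printing Implicit Defensive.
Import Order.TTheory GRing.Theory Num.Theory.
Import numFieldNormedType.Exports.
Local Open Scope classical_set_scope.
Local Open Scope ring_scope.

(** Borel sets and Lebesgue measure on R^n, represented as 'rV[R]_n.  The
    sigma-algebra is generated by the coordinates, as the library does for
    n.-tuple; the measure is the n-fold product of lebesgue_measure. *)

Definition measure_rV_display : measure_display -> measure_display.
Proof. exact. Qed.

Section measurable_rV.
Context {d} {T : sigmaRingType d}.
Variable n : nat.

Let coors : 'I_n -> 'rV[T]_n -> T := fun i x => x ord0 i.

Let rV_set0 : g_sigma_preimage coors set0.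
Proof. exact: sigma_algebra0. Qed.

Let rV_setC A : g_sigma_preimage coors A -> g_sigma_preimage coors (~` A).
Proof. exact: sigma_algebraC. Qed.

Let rV_bigcup (F : (set 'rV[T]_n)^nat) :
  (forall i, g_sigma_preimage coors (F i)) ->
  g_sigma_preimage coors (\bigcup_i (F i)).
Proof. exact: sigma_algebra_bigcup. Qed.

HB.instance Definition _ := @isMeasurable.Build (measure_rV_display d)
  'rV[T]_n (g_sigma_preimage coors) rV_set0 rV_setC rV_bigcup.

End measurable_rV.

Section measurable_fun_rV.
Context d1 d2 (T1 : measurableType d1) (T2 : measurableType d2).

Lemma measurable_fun_coor n (i : 'I_n) :
  measurable_fun [set: 'rV[T2]_n] (fun x : 'rV[T2]_n => x ord0 i).
Proof.
move=> _ Y mY; rewrite setTI; apply: sub_sigma_algebra => /=.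
rewrite -bigcup_seq/=; exists i => /=; first by rewrite mem_index_enum.
by exists Y => //; rewrite setTI.
Qed.

Lemma measurable_fun_rVP n (f : T1 -> 'rV[T2]_n) :
  (forall i, measurable_fun [set: T1] (fun x => f x ord0 i)) ->
  measurable_fun [set: T1] f.
Proof.
move=> mf.
suff : (@measurable _ 'rV[T2]_n) `<=` [set A | measurable (f @^-1` A)].
  by move=> sub _ A mA; rewrite setTI; exact: sub.
apply: smallest_sub => /=.
  split => /=.
  - by rewrite preimage_set0.
  - by move=> A mA; rewrite setTD preimage_setC; exact: measurableC.
  - by move=> F mF; rewrite preimage_bigcup; exact: bigcup_measurable.
rewrite -bigcup_seq/= => _ [i _ [Y mY <-]] /=.
rewrite setTI.
by have := mf i measurableT Y mY; rewrite setTI.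
Qed.

End measurable_fun_rV.

Section cons_rV.
Context {R : realType}.
Variable n : nat.

Definition cons_rV (p : measurableTypeR R * 'rV[R]_n) : 'rV[R]_n.+1 :=
  \row_i (if unlift ord0 i is Some j then p.2 ord0 j else p.1).

Definition uncons_rV (x : 'rV[R]_n.+1) : measurableTypeR R * 'rV[R]_n :=
  (x ord0 ord0, \row_j x ord0 (lift ord0 j)).

Lemma cons_rVK : cancel cons_rV uncons_rV.
Proof.
case=> a v; rewrite /uncons_rV /cons_rV mxE unlift_none/=; congr pair.
by apply/rowP => j; rewrite !mxE liftK.
Qed.

Lemma measurable_cons_rV : measurable_fun [set: measurableTypeR R * 'rV[R]_n] cons_rV.
Proof.
apply: measurable_fun_rVP => i.
under eq_fun do rewrite mxE.
case: (unlift ord0 i) => [j|]; last exact: measurable_fst.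
apply: (measurableT_comp (measurable_fun_coor j)).
exact: measurable_snd.
Qed.

Lemma measurable_uncons_rV : measurable_fun [set: 'rV[R]_n.+1] uncons_rV.
Proof.
apply: measurable_fun_pair; first exact: measurable_fun_coor.
apply: measurable_fun_rVP => i.
under eq_fun do rewrite mxE.
exact: measurable_fun_coor.
Qed.

End cons_rV.
Arguments cons_rV {R n}.
Arguments uncons_rV {R n}.

Section lebesgue_rV_succ.
Context {R : realType}.
Variables (n : nat) (mu : {sigma_finite_measure set 'rV[R]_n -> \bar R}).
Local Open Scope ereal_scope.

Definition lebesgue_rV_succ : set 'rV[R]_n.+1 -> \bar R :=
  pushforward (@lebesgue_measure R \x mu) cons_rV.

Let lebesgue_rV_succ0 : lebesgue_rV_succ set0 = 0.
Proof. by rewrite /lebesgue_rV_succ /pushforward preimage_set0 measure0. Qed.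

Let measurable_preimage_cons A :
  measurable A -> measurable ((@cons_rV R n) @^-1` A).
Proof.
by move=> mA; rewrite -[X in measurable X]setTI; exact: measurable_cons_rV.
Qed.

Let lebesgue_rV_succ_ge0 A : 0 <= lebesgue_rV_succ A.
Proof. by rewrite /lebesgue_rV_succ /pushforward measure_ge0. Qed.

Let lebesgue_rV_succ_sigma_additive : semi_sigma_additive lebesgue_rV_succ.
Proof.
move=> F mF tF mUF; rewrite /lebesgue_rV_succ /pushforward preimage_bigcup.
apply: measure_semi_sigma_additive => [i||].
- exact: measurable_preimage_cons.
- apply/trivIsetP => i j _ _ ij; rewrite -preimage_setI.
  by move/trivIsetP : tF => /(_ _ _ _ _ ij) ->//; rewrite preimage_set0.
- by rewrite -preimage_bigcup; exact: measurable_preimage_cons.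
Qed.

HB.instance Definition _ := isMeasure.Build _ _ _ lebesgue_rV_succ
  lebesgue_rV_succ0 lebesgue_rV_succ_ge0 lebesgue_rV_succ_sigma_additive.

Let lebesgue_rV_succ_sigma_finite : sigma_finite setT lebesgue_rV_succ.
Proof.
have /sigma_finiteP[F [TF ndF Foo]] := sigma_finiteT (@lebesgue_measure R).
have /sigma_finiteP[G [TG ndG Goo]] := sigma_finiteT mu.
exists (fun k => uncons_rV @^-1` (F k `*` G k)).
  apply/esym; rewrite -preimage_bigcup -subTset => x _ /=.
  have : setT (uncons_rV x).1 by [].
  have : setT (uncons_rV x).2 by [].
  rewrite {1}TF {1}TG => -[k _ Gk] [l _ Fl]; exists (maxn l k) => //; split.
    by move: Fl; exact/subsetPset/ndF/leq_maxl.
  by move: Gk; exact/subsetPset/ndG/leq_maxr.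
move=> k; have [mF Fk] := Foo k; have [mG Gk] := Goo k; split.
  rewrite -[X in measurable X]setTI; apply: measurable_uncons_rV => //.
  exact: measurableX.
rewrite /lebesgue_rV_succ /pushforward -comp_preimage.
rewrite (_ : uncons_rV \o cons_rV = id); last first.
  by apply/funext => p /=; rewrite cons_rVK.
by rewrite preimage_id product_measure1E// lte_mul_pinfty// ge0_fin_numE.
Qed.

HB.instance Definition _ := Measure_isSigmaFinite.Build _ _ _
  lebesgue_rV_succ lebesgue_rV_succ_sigma_finite.

End lebesgue_rV_succ.

Fixpoint lebesgue_rV (R : realType) (n : nat) :
    {sigma_finite_measure set 'rV[R]_n -> \bar R} :=
  match n with
  | 0 => \d_ (0 : 'rV[R]_0)
  | n'.+1 => lebesgue_rV_succ (lebesgue_rV R n')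
  end.

Lemma lebesgue_rV_box (R : realType) n (A : 'I_n -> set (measurableTypeR R)) :
  (forall i, measurable (A i)) ->
  lebesgue_rV R n [set x | forall i, A i (x ord0 i)] =
  (\prod_(i < n) lebesgue_measure (A i))%E.
Proof.
elim: n A => [|n ih] A mA.
  by rewrite big_ord0 /= diracE mem_set// => -[].
rewrite big_ord_recl -(ih (fun j => A (lift ord0 j)))//=.
rewrite /lebesgue_rV_succ /pushforward.
pose B := [set x : 'rV[R]_n | forall j, A (lift ord0 j) (x ord0 j)].
rewrite -/B.
have mB : measurable B.
  have -> : B = \bigcap_(i in [set: 'I_n])
      ((fun x : 'rV[R]_n => x ord0 i) @^-1` A (lift ord0 i)).
    by apply/seteqP; split => x Bx i => [_|]; exact: Bx.
  apply: fin_bigcap_measurable => // i _.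
  have := @measurable_fun_coor _ R n i measurableT _ (mA (lift ord0 i)).
  by rewrite setTI.
rewrite -product_measure1E//; congr (product_measure1 _ _ _).
apply/seteqP; split => -[a v] /=.
  move=> H; split; first by have := H ord0; rewrite /cons_rV mxE unlift_none.
  by move=> i; have := H (lift ord0 i); rewrite /cons_rV mxE liftK.
move=> [Aa Bv] i; rewrite /cons_rV mxE.
  by case: unliftP => [j ->|->] //; exact: Bv.
Qed.

(** The norm provided by the library on 'rV[R]_n is the sup norm. *)
Definition enorm (R : realType) (n : nat) (x : 'rV[R]_n) : R :=
  Num.sqrt (\sum_(i < n) x ord0 i ^+ 2).

Section special_functions.
Context {R : realType}.

Definition Gamma (s : R) : R :=
  \int[lebesgue_measure]_(t in `]0, +oo[) (t `^ (s - 1) * expR (- t)).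

(** Modified Bessel function of the second kind, for nu > 0 and r > 0. *)
Definition besselK (nu r : R) : R :=
  (pi / 2) `^ (1 / 2) * r `^ nu * expR (- r) / Gamma (nu + 1 / 2) *
  \int[lebesgue_measure]_(t in `]0, +oo[)
    ((1 + t / 2) `^ (nu - 1 / 2) * expR (- (r * t)) * t `^ (nu - 1 / 2)).

Definition log_kernel (N : nat) (r : R) : R :=
  2 `^ (1 - N%:R / 2) * r `^ (N%:R / 2) * besselK (N%:R / 2) r.

Definition log_const (N : nat) : R := pi `^ (- (N%:R / 2)).

End special_functions.

Section functions_on_rV.
Context {R : realType} {N : nat}.
Implicit Types (u : 'rV[R]_N -> R) (x : 'rV[R]_N) (U : set 'rV[R]_N).
Local Notation mu := (lebesgue_rV R N).
Local Open Scope ereal_scope.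

Definition locally_integrable_rV u :=
  measurable_fun [set: 'rV[R]_N] u /\
  forall K, compact K -> \int[mu]_(x in K) `|u x|%:E < +oo.

Definition L0norm u : \bar R :=
  \int[mu]_x (`|u x| * expR (- enorm x) /
              (1 + enorm x) `^ (N.+1%:R / 2))%R%:E.

Definition L0space u := locally_integrable_rV u /\ L0norm u < +oo.

Definition modulus_of_continuity U u x (r : R) : \bar R :=
  ereal_sup [set `|u x - u y|%R%:E | y in [set y | U y /\ (enorm (x - y) <= r)%R]].

Definition dini_continuous_at U u x :=
  \int[lebesgue_measure]_(r in `]0%R, 1%R[)
    (modulus_of_continuity U u x r * r^-1%:E) < +oo.

Definition dini_continuous U u := forall x, U x -> dini_continuous_at U u x.

Definition log_schrodinger_trunc u x (eps : R) : \bar R :=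
  \int[mu]_(y in [set y | (eps < enorm (x - y))%R])
    ((u x - u y) / enorm (x - y) ^+ N * log_kernel N (enorm (x - y)))%R%:E.

(** The principal value is meaningful when the truncated integrals converge,
    [lim] being total. *)
Definition log_schrodinger u x : \bar R :=
  (log_const N)%:E * lim (log_schrodinger_trunc u x eps @[eps --> 0%R^'+]).

Definition log_schrodinger_solution (m p : R) u :=
  forall x, cvg (log_schrodinger_trunc u x eps @[eps --> 0%R^'+]) /\
    log_schrodinger u x + (m * u x)%:E = (u x `^ p)%:E.

Definition cvg_at_infty u (a : R) :=
  forall e : R, (0 < e)%R ->
    exists M : R, forall x, (M < enorm x)%R -> (`|u x - a| < e)%R.

End functions_on_rV.

(* Main.v *)
Require Import Defs.
From HB Require Import structures.
From mathcomp Require Import all_boot all_order all_algebra.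
From mathcomp Require Import all_classical all_reals all_analysis.
From mathcomp Require Import measurable_realfun.
From mathcomp Require Import ring lra.
Import Order.TTheory GRing.Theory Num.Theory.
Import numFieldNormedType.Exports.
Local Open Scope classical_set_scope.
Local Open Scope ring_scope.
Set Implicit Arguments.
Unset Strict Implicit.
Unset Printing Implicit Defensive.

(** Moving planes. For a unit vector e and a real l let T be the reflection in
    the hyperplane {x.e = l} and w = u o T - u. Subtracting the equations at T x
    and x and symmetrising the integral shows that, at a negative minimum x of w
    over {y.e <= l}, a weighted integral of the kernel difference
    J(x - T y) - J(x - y) is bounded by a local term. Three consequences drive
    the method: u x >= (m/p)^(1/(p-1)), so x stays in a ball because
    a < (m/p)^(1/(p-1)); x stays away from the hyperplane, since J behaves like
    r^-N near 0 and is not integrable there; and if w >= 0 vanishes at one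
    point of the open half-space then w = 0. Hence each direction has a
    hyperplane of symmetry up to which u increases. The N coordinate
    hyperplanes give a centre of symmetry, and every other hyperplane of
    symmetry passes through it unless u is periodic along e, hence constant. *)

(** * Invariance of Lebesgue measure under reflections *)

Section translation_invariance.
Context {R : realType}.
Local Notation leb := (@lebesgue_measure R).

(** The three consequences are one inequality read with three test functions. If [f] >= 0 lies below
    minus the symmetrised integrand and lives on the far side of the hyperplane, its integral is at
    most twice the difference of the principal values at [x0] and at [T x0]. Taking [f] = 0, a
    multiple of the kernel on a half-space, and a multiple of the indicator of a cube gives the
    bound on u x, the distance to the hyperplane and the strong maximum principle.

    The obstacle is that the symmetrised integrals need not converge absolutely, and that truncating
    at distance eps is not symmetric: near [x0] the kernel is cut while its mirror image is not. All
    manipulations are therefore done at fixed eps. There the unfavourable part is bounded by the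
    kernel at the distance [d] from [x0] to the hyperplane, on balls of radius eps, so it is
    O(eps^N) and vanishes in the limit.

    The threshold (m/p)^(1/(p-1)) is the value of b at which p b^(p-1) - m, the slope of b^p - m b,
    changes sign. The bounds on negative minima are uniform in direction and hyperplane, which lets
    the plane be pushed beyond a supposed last position. *)

Let mshift (c : R) : measurable_fun [set: measurableTypeR R]
  ((fun x : R => x + c) : measurableTypeR R -> measurableTypeR R).
Proof. exact: measurable_funD. Qed.

Lemma lebesgue_measure_shift (c : R) (A : set (measurableTypeR R)) :
  measurable A -> leb ((fun x => x + c) @^-1` A) = leb A.
Proof.
move=> mA.
pose f : {mfun measurableTypeR R >-> measurableTypeR R} :=
  HB.pack (fun x : measurableTypeR R => x + c : measurableTypeR R)
   (isMeasurableFun.Build _ _ _ _ _ (mshift c)).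
suff fE X : ocitv X -> leb X = pushforward leb f X.
  exact/esym/(lebesgue_measure_unique fE mA).
move=> [[a b] _ <-] /=; rewrite /pushforward /=.
rewrite (_ : _ @^-1` _ = `]a - c, b - c]%classic); last first.
  by apply/seteqP; split => x /=; rewrite !in_itv/= ltrBlDr lerBrDr.
rewrite !lebesgue_measure_itv/= !lte_fin ltrD2r.
by case: ifP => // _; rewrite -!EFinB; congr EFin; ring.
Qed.

Lemma ge0_integral_lebesgue_shift (c : R) (f : R -> \bar R) :
  measurable_fun [set: R] f -> (forall x, 0 <= f x)%E ->
  (\int[leb]_x f (x + c)%R = \int[leb]_x f x)%E.
Proof.
move=> mf f0.
have := @ge0_integral_pushforward _ _ _ _ R _ (mshift c) leb setT f measurableT mf.
rewrite preimage_setT => <- //.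
apply: eq_measure_integral => A mA _; exact: lebesgue_measure_shift.
Qed.

End translation_invariance.

Section translation_rV.
Context {R : realType}.

Lemma measurable_coord n (i : 'I_n) :
  measurable_fun [set: 'rV[R]_n] (fun x : 'rV[R]_n => x ord0 i : R).
Proof. exact: measurable_fun_coor. Qed.

Lemma measurable_addrV n (c : 'rV[R]_n) :
  measurable_fun [set: 'rV[R]_n] (fun x : 'rV[R]_n => x + c).
Proof.
apply: measurable_fun_rVP => i; under eq_fun do rewrite mxE.
by apply: measurable_funD => //; exact: measurable_coord.
Qed.

Lemma ge0_integral_rV_succ n (f : 'rV[R]_n.+1 -> \bar R) :
  measurable_fun setT f -> (forall x, 0 <= f x)%E ->
  (\int[lebesgue_rV R n.+1]_x f x =
   \int[@lebesgue_measure R]_a \int[lebesgue_rV R n]_v f (cons_rV (a, v)))%E.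
Proof.
move=> mf f0.
rewrite (_ : (\int[_]_x f x = \int[@lebesgue_measure R \x lebesgue_rV R n]_p (f \o cons_rV) p)%E).
  rewrite fubini_tonelli1//; last by move=> x; exact: f0.
  by apply: measurableT_comp => //; exact: measurable_cons_rV.
have := @ge0_integral_pushforward _ _ _ _ R _ (@measurable_cons_rV R n)
   (@lebesgue_measure R \x lebesgue_rV R n)%E setT f measurableT mf.
by rewrite preimage_setT => <- //= y _; exact: f0.
Qed.

(** Tonelli splits off the first coordinate: the others are shifted by induction, the first by
    invariance on the line. *)
Lemma ge0_integral_rV_shift n (c : 'rV[R]_n) (f : 'rV[R]_n -> \bar R) :
  measurable_fun setT f -> (forall x, 0 <= f x)%E ->
  (\int[lebesgue_rV R n]_x f (x + c)%R = \int[lebesgue_rV R n]_x f x)%E.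
Proof.
elim: n c f => [|n ih] c f mf f0.
  apply: eq_integral => x _; congr f; by apply/rowP => -[].
have mc := @measurable_cons_rV R n.
rewrite ge0_integral_rV_succ//; last first.
  by apply: (measurableT_comp mf); exact: measurable_addrV.
rewrite [RHS](ge0_integral_rV_succ mf f0).
pose c' : 'rV[R]_n := \row_j c ord0 (lift ord0 j).
have consD a v : cons_rV (a, v) + c = cons_rV (a + c ord0 ord0, v + c').
  apply/rowP => i; rewrite !mxE.
  by case: unliftP => [j ->|->] //; rewrite !mxE.
pose F (a : R) : \bar R := (\int[lebesgue_rV R n]_v f (cons_rV (a, v)))%E.
transitivity (\int[@lebesgue_measure R]_a F (a + c ord0 ord0)%R)%E.
  apply: eq_integral => a _; rewrite /F.
  under eq_integral do rewrite consD.
  apply: (ih c' (fun v => f (cons_rV (a + c ord0 ord0, v)))) => [|x]; last exact: f0.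
  apply: measurableT_comp => //; apply: measurableT_comp => //.
apply: ge0_integral_lebesgue_shift => [|x]; last first.
  by apply: integral_ge0 => v _; exact: f0.
apply: (@measurable_fun_fubini_tonelli_F _ _ _ _ R (lebesgue_rV R n)
    (fun p => f (cons_rV p))); first exact: measurableT_comp.
by move=> p; exact: f0.
Qed.

End translation_rV.

Definition dot (R : realType) (n : nat) (x y : 'rV[R]_n) : R :=
  \sum_(i < n) x ord0 i * y ord0 i.

Definition refl (R : realType) (n : nat) (e : 'rV[R]_n) (l : R) (x : 'rV[R]_n) :
  'rV[R]_n := x + (2 * (l - dot x e)) *: e.

(** * Euclidean geometry of hyperplane reflections *)

Section euclidean.
Context {R : realType} {n : nat}.
Implicit Types (x y z e : 'rV[R]_n) (l c : R).

Lemma dotC x y : dot x y = dot y x.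
Proof. by apply: eq_bigr => i _; rewrite mulrC. Qed.

Lemma dotDl x y z : dot (x + y) z = dot x z + dot y z.
Proof. by rewrite /dot -big_split/=; apply: eq_bigr => i _; rewrite mxE mulrDl. Qed.

Lemma dotZl c x y : dot (c *: x) y = c * dot x y.
Proof. by rewrite /dot mulr_sumr; apply: eq_bigr => i _; rewrite mxE mulrA. Qed.

Lemma dotDr x y z : dot z (x + y) = dot z x + dot z y.
Proof. by rewrite !(dotC z) dotDl. Qed.

Lemma dotZr c x y : dot x (c *: y) = c * dot x y.
Proof. by rewrite !(dotC x) dotZl. Qed.

Lemma dotNl x y : dot (- x) y = - dot x y.
Proof. by rewrite -scaleN1r dotZl mulN1r. Qed.

Lemma dotNr x y : dot x (- y) = - dot x y.
Proof. by rewrite !(dotC x) dotNl. Qed.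

Lemma dot0l x : dot 0 x = 0.
Proof. by rewrite -(scale0r 0) dotZl mul0r. Qed.

Definition dotE := (dotDl, dotDr, dotZl, dotZr, dotNl, dotNr).

Lemma dot_ge0 x : 0 <= dot x x.
Proof. by apply: sumr_ge0 => i _; rewrite -expr2 sqr_ge0. Qed.

Lemma dot_eq0 x : (dot x x == 0) = (x == 0).
Proof.
apply/idP/eqP => [|->]; last by rewrite dot0l.
rewrite psumr_eq0 => [/allP h|i _]; last by rewrite -expr2 sqr_ge0.
by apply/rowP => i; have := h i (mem_index_enum _); rewrite /= mulf_eq0 orbb mxE => /eqP.
Qed.

Lemma enormE x : enorm x = Num.sqrt (dot x x).
Proof. by []. Qed.

Lemma enorm_ge0 x : 0 <= enorm x.
Proof. exact: sqrtr_ge0. Qed.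

Lemma sqr_enorm x : enorm x ^+ 2 = dot x x.
Proof. by rewrite sqr_sqrtr// dot_ge0. Qed.

Lemma enorm_eq0 x : (enorm x == 0) = (x == 0).
Proof. by rewrite -sqrf_eq0 sqr_enorm dot_eq0. Qed.

Lemma enorm0 : enorm (0 : 'rV[R]_n) = 0.
Proof. by apply/eqP; rewrite enorm_eq0. Qed.

Lemma enormN x : enorm (- x) = enorm x.
Proof. by rewrite !enormE dotNl dotNr opprK. Qed.

Lemma enormB x y : enorm (x - y) = enorm (y - x).
Proof. by rewrite -enormN opprB. Qed.

Lemma enormZ c x : enorm (c *: x) = `|c| * enorm x.
Proof. by rewrite !enormE dotZl dotZr mulrA -expr2 sqrtrM ?sqr_ge0// sqrtr_sqr. Qed.

Lemma le_enorm x y : (enorm x <= enorm y) = (dot x x <= dot y y).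
Proof. by rewrite !enormE ler_sqrt// dot_ge0. Qed.

Lemma dot_le_enorm x y : dot x y <= enorm x * enorm y.
Proof.
have [->|x0] := eqVneq x 0; first by rewrite dot0l enorm0 mul0r.
have [->|y0] := eqVneq y 0; first by rewrite dotC dot0l enorm0 mulr0.
have nx : 0 < enorm x by rewrite lt0r enorm_eq0 x0 enorm_ge0.
have ny : 0 < enorm y by rewrite lt0r enorm_eq0 y0 enorm_ge0.
have := dot_ge0 (enorm y *: x - enorm x *: y).
rewrite !dotE -!sqr_enorm (dotC y x) => h.
have xy : 0 < enorm x * enorm y by exact: mulr_gt0.
rewrite -(ler_pM2l xy); nra.
Qed.

Lemma enormD x y : enorm (x + y) <= enorm x + enorm y.
Proof.
rewrite -ler_sqr ?nnegrE ?addr_ge0 ?enorm_ge0// sqr_enorm !dotE (dotC y x).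
by rewrite -!sqr_enorm; have := dot_le_enorm x y; nra.
Qed.

Lemma dot_norm_le x y : `|dot x y| <= enorm x * enorm y.
Proof.
rewrite ler_norml dot_le_enorm andbT lerNl -dotNl.
by have := dot_le_enorm (- x) y; rewrite enormN.
Qed.

Lemma enorm_dist x y : enorm x - enorm y <= enorm (x - y).
Proof. by rewrite lerBlDr -{1}(subrK y x) enormD. Qed.

Lemma coord_le_enorm x i : `|x ord0 i| <= enorm x.
Proof.
rewrite -sqrtr_sqr ler_sqrt ?dot_ge0// (bigD1 i)//= lerDl.
by apply: sumr_ge0 => j _; exact: sqr_ge0.
Qed.

Lemma enorm_le_coord x c : (forall i, `|x ord0 i| <= c) -> enorm x <= n%:R * c.
Proof.
have [n0|n0 xc] := posnP n.
  move=> _; rewrite enormE /dot big1 ?sqrtr0 ?n0 ?mul0r// => -[i hi] _.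
  by exfalso; move: (hi); rewrite n0.
have c0 : 0 <= c by apply: le_trans (xc (Ordinal n0)).
rewrite -(ler_sqr (enorm_ge0 _)) ?nnegrE ?mulr_ge0// sqr_enorm.
apply: (@le_trans _ _ (\sum_(i < n) c ^+ 2)).
  apply: ler_sum => i _; rewrite -expr2 -[leLHS]real_normK ?num_real//.
  by rewrite ler_sqr ?nnegrE.
rewrite sumr_const card_ord exprMn.
rewrite -[_ *+ n]mulr_natl; apply: ler_wpM2r; first exact: sqr_ge0.
by rewrite -natrX ler_nat leq_pmulr.
Qed.

Section reflection.
Variable e : 'rV[R]_n.
Hypothesis e1 : dot e e = 1.

Lemma dot_refl l x : dot (refl e l x) e = 2 * l - dot x e.
Proof. by rewrite dotDl dotZl e1; ring. Qed.

Lemma reflK l : involutive (refl e l).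
Proof.
move=> x; rewrite {1}/refl dot_refl /refl -addrA -scalerDl.
rewrite (_ : 2 * _ + 2 * _ = 0); first by rewrite scale0r addr0.
by ring.
Qed.

Lemma refl_fix l x : dot x e = l -> refl e l x = x.
Proof. by rewrite /refl => ->; rewrite subrr mulr0 scale0r addr0. Qed.

Lemma reflB l x y : refl e l x - refl e l y = refl e 0 (x - y).
Proof.
rewrite /refl opprD addrACA -scalerBl dotDl dotNl; congr (_ + _ *: _); ring.
Qed.

Lemma enorm_refl0 x : enorm (refl e 0 x) = enorm x.
Proof.
rewrite !enormE; congr Num.sqrt; rewrite !dotE (dotC e x) e1; ring.
Qed.

Lemma enorm_reflB l x y : enorm (refl e l x - refl e l y) = enorm (x - y).
Proof. by rewrite reflB enorm_refl0. Qed.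

Lemma enorm_refl_swap l x y : enorm (refl e l x - y) = enorm (x - refl e l y).
Proof. by rewrite -{1}(reflK l y) enorm_reflB. Qed.

(** [refl e l] is the linear isometry [refl e 0] followed by the translation by 2 l e. *)
Lemma enorm_refl_ge l x : enorm x - 2 * `|l| <= enorm (refl e l x).
Proof.
have h : enorm (refl e 0 x) <= enorm (refl e l x) + 2 * `|l|.
  have -> : refl e 0 x = refl e l x + (- (2 * l)) *: e.
    by rewrite /refl -addrA -scalerDl; congr (_ + _ *: _); ring.
  rewrite (le_trans (enormD _ _))// lerD2l enormZ normrN normrM.
  by rewrite [enorm e]enormE e1 sqrtr1 mulr1 ger0_norm.
by rewrite enorm_refl0 in h; rewrite lerBlDr.
Qed.

(** The difference of the squared distances is 4 (l - x.e) (l - z.e). *)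
Lemma refl_farther l x z : dot x e <= l -> dot z e <= l ->
  enorm (x - z) <= enorm (x - refl e l z).
Proof.
move=> xl zl; rewrite le_enorm /refl !dotE (dotC e x) (dotC e z) (dotC z x) e1.
by nra.
Qed.

Lemma refl_farther_lt l x z : dot x e < l -> dot z e < l ->
  enorm (x - z) < enorm (x - refl e l z).
Proof.
move=> xl zl; rewrite lt_neqAle refl_farther ?ltW// andbT.
apply/negP => /eqP /(congr1 (fun r => r ^+ 2)); rewrite !sqr_enorm.
rewrite /refl !dotE (dotC e x) (dotC e z) (dotC z x) e1 => h.
have : (l - dot x e) * (l - dot z e) = 0 by lra.
move/eqP; rewrite mulf_eq0 => /orP[] /eqP; lra.
Qed.

End reflection.

Lemma reflN e l x : refl (- e) (- l) x = refl e l x.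
Proof. by rewrite /refl dotNr scalerN -scaleNr; congr (_ + _ *: _); ring. Qed.

End euclidean.

Section measurability_rV.
Context {R : realType} {n : nat}.

Lemma measurable_dot (e : 'rV[R]_n) :
  measurable_fun [set: 'rV[R]_n] (fun x : 'rV[R]_n => dot x e).
Proof.
apply: measurable_sum => i; apply: measurable_funM => //; exact: measurable_coord.
Qed.

Lemma measurable_enorm : measurable_fun [set: 'rV[R]_n] (fun x : 'rV[R]_n => enorm x).
Proof.
apply: (@measurableT_comp _ _ _ _ _ _ (@Num.sqrt R)).
  by apply: continuous_measurable_fun; exact: sqrt_continuous.
by apply: measurable_sum => i; apply: measurable_funX; exact: measurable_coord.
Qed.

Lemma measurable_refl (e : 'rV[R]_n) (l : R) :
  measurable_fun [set: 'rV[R]_n] (refl e l).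
Proof.
apply: measurable_fun_rVP => i; rewrite /refl; under eq_fun do rewrite !mxE.
apply: measurable_funD; first exact: measurable_coord.
apply: measurable_funM => //; apply: measurable_funM => //.
by apply: measurable_funB => //; exact: measurable_dot.
Qed.

Lemma measurable_addrV2 d (T : measurableType d) (f g : T -> 'rV[R]_n) :
  measurable_fun setT f -> measurable_fun setT g ->
  measurable_fun setT (fun t => f t + g t).
Proof.
move=> mf mg; apply: measurable_fun_rVP => i; under eq_fun do rewrite mxE.
apply: measurable_funD.
- by apply: (measurableT_comp (measurable_coord i)).
- by apply: (measurableT_comp (measurable_coord i)).
Qed.

Lemma measurable_subrV (c : 'rV[R]_n) :
  measurable_fun [set: 'rV[R]_n] (fun x : 'rV[R]_n => c - x).
Proof.
apply: measurable_fun_rVP => i; under eq_fun do rewrite !mxE.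
by apply: measurable_funB => //; exact: measurable_coord.
Qed.

Definition cube (z : 'rV[R]_n) (c : R) : set 'rV[R]_n :=
  [set x | forall i, `|x ord0 i - z ord0 i| <= c].

Lemma cubeE z c : cube z c =
  [set x | forall i, (`[z ord0 i - c, z ord0 i + c]%classic : set (measurableTypeR R)) (x ord0 i)].
Proof.
by apply/seteqP; split=> x /= h i; have := h i;
  rewrite /= in_itv/= ler_distl.
Qed.

Lemma measurable_cube z c : measurable (cube z c).
Proof.
rewrite cubeE [X in measurable X](_ : _ = \bigcap_(i in [set: 'I_n])
    ((fun x : 'rV[R]_n => x ord0 i) @^-1` `[z ord0 i - c, z ord0 i + c]%classic)); last first.
  by apply/seteqP; split => x h i => [_|]; exact: h.
apply: fin_bigcap_measurable => // i _.
rewrite -[X in measurable X]setTI.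
exact: (@measurable_coord _ _ i measurableT).
Qed.

Lemma lebesgue_cube z c : 0 <= c -> lebesgue_rV R n (cube z c) = ((2 * c) ^+ n)%:E.
Proof.
move=> c0; rewrite cubeE.
pose A i : set (measurableTypeR R) := `[z ord0 i - c, z ord0 i + c]%classic.
transitivity (\prod_(i < n) lebesgue_measure (A i))%E.
  by apply: (@lebesgue_rV_box R n A) => i; exact: measurable_itv.
rewrite /A.
under eq_bigr do rewrite lebesgue_measure_itv/= lte_fin.
rewrite (eq_bigr (fun=> (2 * c)%:E)) => [|i _]; last first.
  case: ifPn => [_|]; first by rewrite -EFinB; congr EFin; ring.
  by rewrite -leNgt => h; congr EFin; lra.
by rewrite prodEFin prodr_const card_ord.
Qed.

Definition eball (c : R) : set 'rV[R]_n := [set x | enorm x <= c].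

Lemma measurable_eball c : measurable (eball c).
Proof.
rewrite [X in measurable X](_ : _ = setT `&` (fun x => enorm x) @^-1` `]-oo, c]%classic).
  exact: measurable_enorm.
by rewrite setTI; apply/seteqP; split=> x; rewrite /eball /= in_itv.
Qed.

Lemma eball_sub_cube c : eball c `<=` cube 0 c.
Proof. by move=> x xc i; rewrite mxE subr0 (le_trans (coord_le_enorm _ _)). Qed.

Lemma cube_sub_eball c : cube 0 c `<=` eball (n%:R * c).
Proof. by move=> x xc; apply: enorm_le_coord => i; have := xc i; rewrite mxE subr0. Qed.

End measurability_rV.

Section reflection_invariance.
Context {R : realType} {n : nat} (e : 'rV[R]_n).
Hypothesis e1 : dot e e = 1.
Local Notation mu := (lebesgue_rV R n).
Local Notation T := (refl e 0).

Let TD x y : T (x + y) = T x + T y.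
Proof. rewrite /refl dotDl addrACA -scalerDl; congr (_ + _ *: _); ring. Qed.

Let B : set 'rV[R]_n := eball 1.

Let muB_fin : (mu B < +oo)%E.
Proof.
apply: (@le_lt_trans _ _ (mu (cube 0 1))); last by rewrite lebesgue_cube// ltry.
apply: le_measure; rewrite ?inE; [exact: measurable_eball|exact: measurable_cube|].
exact: eball_sub_cube.
Qed.

Let muB_gt0 : (0 < mu B)%E.
Proof.
have c0 : 0 < n.+1%:R^-1 :> R by rewrite invr_gt0.
apply: (@lt_le_trans _ _ (mu (cube 0 n.+1%:R^-1))).
  by rewrite lebesgue_cube ?ltW// lte_fin exprn_gt0// mulr_gt0.
apply: le_measure; rewrite ?inE; [exact: measurable_cube|exact: measurable_eball|].
move=> x /cube_sub_eball; rewrite /B /eball/= => /le_trans; apply.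
by rewrite ler_pdivrMr// mul1r ler_nat.
Qed.

(** Only translation invariance is used, no Jacobian. Let g be the indicator of the unit ball,
    invariant under T and under sign change. Then mu B times the integral of f o T is the double
    integral of g(T y - x) f(T y). Substituting y + T x for y turns the integrand into g(T y) f(x +
    T y), and integrating in x first gives mu B times the integral of f. Since mu B is positive and
    finite, it cancels. *)
Let ge0_integral_refl0 (f : 'rV[R]_n -> \bar R) :
  measurable_fun setT f -> (forall x, 0 <= f x)%E ->
  (\int[mu]_x f (T x) = \int[mu]_x f x)%E.
Proof.
move=> mf f0.
have mT := @measurable_refl R n e 0.
pose g (x : 'rV[R]_n) : \bar R := (\1_B x)%:E.
have mg : measurable_fun setT g.
  by apply/measurable_EFinP; apply: measurable_indic; exact: measurable_eball.
have g0 x : (0 <= g x)%E by rewrite lee_fin.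
have gE x : g x = ((enorm x <= 1)%R : bool)%:R%:E.
  rewrite /g indicE; case: (boolP (enorm x <= 1)) => h; first by rewrite mem_set.
  by rewrite memNset//; exact/negP.
have gT x : g (T x) = g x by rewrite !gE enorm_refl0.
have gN x : g (- x) = g x by rewrite !gE enormN.
have Ig : (\int[mu]_x g x = mu B)%E.
  by rewrite integral_indic ?setIT//; exact: measurable_eball.
have mf' x : measurable_fun setT (fun y => f (x + T y)).
  by apply: (measurableT_comp mf); exact: measurable_addrV2.
have mh : measurable_fun setT (fun p : 'rV[R]_n * 'rV[R]_n => g (T p.2) * f (p.1 + T p.2)%R)%E.
  apply: emeasurable_funM.
    by apply: (measurableT_comp mg); apply: (measurableT_comp mT); exact: measurable_snd.
  apply: (measurableT_comp mf); apply: measurable_addrV2; first exact: measurable_fst.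
  by apply: (measurableT_comp mT); exact: measurable_snd.
have mh' : measurable_fun setT (fun p : 'rV[R]_n * 'rV[R]_n => g (T p.2 - p.1)%R * f (T p.2))%E.
  apply: emeasurable_funM; last first.
    by apply: (measurableT_comp mf); apply: (measurableT_comp mT); exact: measurable_snd.
  apply: (measurableT_comp mg); apply: measurable_addrV2.
    by apply: (measurableT_comp mT); exact: measurable_snd.
  have := measurableT_comp (@measurable_subrV R n 0) (@measurable_fst _ _ 'rV[R]_n 'rV[R]_n).
  by apply: eq_measurable_fun => p _ /=; rewrite sub0r.
suff : (mu B * \int[mu]_x f (T x) = mu B * \int[mu]_x f x)%E.
  have muBf : mu B \is a fin_num by rewrite ge0_fin_numE.
  have m0 : fine (mu B) != 0 by apply: lt0r_neq0; apply: fine_gt0; rewrite muB_gt0.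
  rewrite -(fineK muBf) => /(congr1 (fun z => (fine (mu B))^-1%:E * z)%E).
  by rewrite !muleA -!EFinM mulVf// !mul1e.
transitivity (\int[mu]_y \int[mu]_x (g (T y - x)%R * f (T y)))%E.
  rewrite -ge0_integralZl//.
  - apply: eq_integral => y _.
    rewrite ge0_integralZr//; last first.
      by apply: (measurableT_comp mg); exact: measurable_subrV.
    have shiftg := ge0_integral_rV_shift (- T y) mg g0; rewrite Ig in shiftg.
    congr (_ * _)%E; rewrite -shiftg.
    by apply: eq_integral => x _; rewrite -gN opprB.
  - by apply: (measurableT_comp mf mT).
rewrite -(@fubini_tonelli _ _ _ _ R mu mu (fun p => g (T p.2 - p.1)%R * f (T p.2))%E)//; last first.
  by move=> p; exact: mule_ge0.
transitivity (\int[mu]_x \int[mu]_y (g (T y) * f (x + T y)%R))%E.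
  apply: eq_integral => x _.
  rewrite -(@ge0_integral_rV_shift _ _ (T x) (fun y => g (T y - x)%R * f (T y))%E).
  - apply: eq_integral => y _; rewrite TD (reflK e1); congr (g _ * f _)%E.
      by rewrite addrK.
    by rewrite addrC.
  - apply: emeasurable_funM; last exact: (measurableT_comp mf).
    by apply: (measurableT_comp mg); exact: measurable_addrV2.
  - by move=> y; exact: mule_ge0.
rewrite (@fubini_tonelli _ _ _ _ R mu mu (fun p => g (T p.2) * f (p.1 + T p.2)%R)%E)//; last first.
  by move=> p; exact: mule_ge0.
rewrite -Ig -ge0_integralZr//; last exact: integral_ge0.
apply: eq_integral => y _ /=; rewrite gT ge0_integralZl//; last first.
  by apply: (measurableT_comp mf); exact: measurable_addrV.
by congr (_ * _)%E; exact: ge0_integral_rV_shift.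
Qed.

Lemma ge0_integral_refl (l : R) (f : 'rV[R]_n -> \bar R) :
  measurable_fun setT f -> (forall x, 0 <= f x)%E ->
  (\int[mu]_x f (refl e l x) = \int[mu]_x f x)%E.
Proof.
move=> mf f0; rewrite -(ge0_integral_rV_shift ((2 * l) *: e) mf f0).
rewrite -(ge0_integral_refl0 (f := fun x => f (x + (2 * l) *: e))) => [||x]; last exact: f0.
  apply: eq_integral => x _; congr f.
  by rewrite /refl -addrA -scalerDl; congr (_ + _ *: _); ring.
by apply: (measurableT_comp mf); exact: measurable_addrV.
Qed.

End reflection_invariance.

(** * Integrability of exponentially decaying functions *)

Section exponential_decay.
Context {R : realType}.

Lemma ler1D_expR (K : nat) (t : R) : (0 < K)%N -> 0 <= t ->
  1 + t <= K%:R * expR (t / K%:R).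
Proof.
move=> K0 t0; have K0' : 0 < K%:R :> R by rewrite ltr0n.
apply: (@le_trans _ _ (K%:R * (1 + t / K%:R))).
  by rewrite mulrDr mulr1 mulrCA mulfV ?gt_eqF// mulr1 lerD2r ler1n.
by rewrite ler_pM2l// expR_ge1Dx.
Qed.

(** [K] is a free parameter: a large [K] makes the exponential rate n/K as small as desired. *)
Lemma exp_ler1D_expR (n K : nat) (t : R) : (0 < K)%N -> 0 <= t ->
  (1 + t) ^+ n <= K%:R ^+ n * expR (n%:R / K%:R * t).
Proof.
move=> K0 t0; apply: (@le_trans _ _ ((K%:R * expR (t / K%:R)) ^+ n)).
  rewrite lerXn2r ?nnegrE ?addr_ge0 ?mulr_ge0 ?expR_ge0//; exact: ler1D_expR.
rewrite exprMn -expRM_natl.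
by rewrite mulrA mulrAC.
Qed.

Lemma integral_expRN_enorm n :
  (\int[lebesgue_rV R n]_z (expR (- enorm z))%:E < +oo)%E.
Proof.
have mE : measurable_fun [set: 'rV[R]_n] (fun z => (expR (- enorm z))%:E).
  apply/measurable_EFinP; apply: (measurableT_comp (@measurable_expR R)).
  by apply: measurableT_comp => //; exact: measurable_enorm.
(* On the shell k <= |z| < k + 1 the exponential is at most e^(-k), and the shell lies in the cube
   of half-side k + 1. *)
pose F k (z : 'rV[R]_n) : \bar R := (expR (- k%:R) * \1_(cube 0 k.+1%:R) z)%:E.
have F0 k z : (0 <= F k z)%E by rewrite lee_fin mulr_ge0// expR_ge0.
have mF k : measurable_fun [set: 'rV[R]_n] (F k).
  apply/measurable_EFinP; apply: measurable_funM => //.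
  by apply: measurable_indic; exact: measurable_cube.
apply: (@le_lt_trans _ _ (\int[lebesgue_rV R n]_z \sum_(0 <= k <oo) F k z)%E).
  apply: ge0_le_integral => //.
  - exact: (@ge0_emeasurable_sum _ _ _ setT F predT (fun k x _ _ => F0 k x) (fun k _ => mF k)).
  move=> z _; pose k := Num.trunc (enorm z).
  have /andP[k1 k2] : k%:R <= enorm z < k.+1%:R by exact/truncn_itv/enorm_ge0.
  apply: (@le_trans _ _ (F k z)).
    rewrite lee_fin indicE mem_set ?mulr1 ?ler_expR ?lerN2//.
    by apply: eball_sub_cube; exact: ltW.
  rewrite (le_trans _ (nneseries_lim_ge k.+1 _))//.
  by rewrite big_nat_recr//= leeDr// sume_ge0.
rewrite integral_nneseries//.
(* This choice gives n/K <= 1/2, so the volumes grow at most like e^(k/2) and a geometric series of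
   ratio e^(-1/2) remains. *)
pose K := (2 * n.+1)%N.
pose C : R := (2 * K%:R) ^+ n.
pose q : R := expR (- 2^-1).
have Fle k : (\int[lebesgue_rV R n]_z F k z <= (C * q ^+ k)%:E)%E.
  under eq_integral do rewrite /F EFinM.
  rewrite ge0_integralZl//; last first.
  - by apply/measurable_EFinP; apply: measurable_indic; exact: measurable_cube.
  rewrite integral_indic//; last exact: measurable_cube.
  rewrite setIT [X in (_ * X)%E](_ : _ = ((2 * k.+1%:R) ^+ n)%:E); last exact: lebesgue_cube.
  rewrite -EFinM lee_fin exprMn.
  apply: (@le_trans _ _ (expR (- k%:R) * (2 ^+ n * (K%:R ^+ n * expR (n%:R / K%:R * k%:R))))).
    rewrite ler_pM2l ?expR_gt0// ler_wpM2l ?exprn_ge0//.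
    rewrite -nat1r; exact: exp_ler1D_expR.
  rewrite (_ : _ * (_ * _) = C * (expR (- k%:R) * expR (n%:R / K%:R * k%:R))); last first.
    by rewrite /C exprMn; ring.
  apply: ler_wpM2l; first by rewrite exprn_ge0// mulr_ge0.
  rewrite -expRD /q -expRM_natl ler_expR.
  have : n%:R / K%:R <= 2^-1 :> R.
    rewrite ler_pdivrMr ?ltr0n// /K natrM mulrA mulVf// mul1r ler_nat //.
  have : 0 <= k%:R :> R by [].
  by nra.
apply: (@le_lt_trans _ _ (C * (1 - q)^-1)%:E); last by rewrite ltry.
have q0 : 0 < q by exact: expR_gt0.
have q1 : q < 1 by rewrite expR_lt1; lra.
apply: lime_le; first by apply: is_cvg_nneseries => k _ _; exact: integral_ge0.
apply: nearW => m.
apply: (@le_trans _ _ (\sum_(0 <= k < m) (C * q ^+ k)%:E)%E).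
  by apply: lee_sum => k _; exact: Fle.
rewrite sumEFin lee_fin.
have := @geometric_le_lim R m C q; apply => //; first by rewrite exprn_ge0// mulr_ge0.
by rewrite ger0_norm ?ltW.
Qed.

End exponential_decay.

(** * The kernel *)

Section half_line_integrals.
Context {R : realType}.
Local Notation leb := (@lebesgue_measure R).
Implicit Types (f : R -> R) (a b c d M : R).

Lemma integrable_exp_bound f M d : measurable_fun [set: R] f -> 0 < d ->
  (forall t, 0 < t -> 0 <= f t <= M * expR (- (d * t))) ->
  leb.-integrable `]0, +oo[ (EFin \o f).
Proof.
move=> mf d0 fM.
have ipdf : leb.-integrable `]0, +oo[ (EFin \o (fun t => M / d * exponential_pdf d t)).
  rewrite (_ : _ \o _ = (fun t => (M / d)%:E * (EFin \o exponential_pdf d) t)%E); last first.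
    by apply/funext => t /=; rewrite EFinM.
  apply: integrableZl => //; apply: integrableS (integrable_exponential_pdf d0) => //.
apply: le_integrable ipdf => //.
  by apply/measurable_EFinP; exact: measurable_funTS.
move=> t /=; rewrite in_itv/= andbT => t0; rewrite lee_fin.
have /andP[f0 fle] := fM t t0.
rewrite ger0_norm// (le_trans _ (ler_norm _))// (le_trans fle)//.
rewrite exponential_pdfE; last exact: ltW.
rewrite mulrA divfK ?gt_eqF//.
by rewrite mulNr.
Qed.

(** Integrability is essential: a real-valued integral that diverges takes the value 0, so
    positivity of the integrand alone bounds nothing from below. *)
Lemma Rintegral_itv_lb f a b c : measurable_fun [set: R] f ->
  leb.-integrable `]0, +oo[ (EFin \o f) ->
  (forall t, 0 < t -> 0 <= f t) ->
  0 < a -> a <= b -> 0 <= c -> (forall t, a <= t <= b -> c <= f t) ->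
  c * (b - a) <= \int[leb]_(t in `]0, +oo[) f t.
Proof.
move=> mf fint f0 a0 ab c0 cf.
rewrite -lee_fin fineK; last exact: integrable_fin_num.
have -> : (c * (b - a))%:E = (\int[leb]_(t in `[a, b]) c%:E)%E.
  rewrite integral_cst//= lebesgue_measure_itv/= lte_fin.
  case: ifPn => [_|]; first by rewrite -EFinB EFinM.
  by rewrite -leNgt => ba; rewrite (_ : b - a = 0) ?mulr0 ?mule0//; lra.
apply: (@le_trans _ _ (\int[leb]_(t in `[a, b]) (f t)%:E)%E).
  apply: ge0_le_integral => //.
  by apply/measurable_EFinP; exact: measurable_funTS.
apply: ge0_subset_integral => //.
- by apply/measurable_EFinP; exact: measurable_funTS.
- by move=> t /=; rewrite in_itv/= andbT lee_fin => /f0.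
- move=> t /=; rewrite !in_itv/= andbT => /andP[at_ _]; exact: lt_le_trans at_.
Qed.

End half_line_integrals.

Section kernel.
Context {R : realType} (N : nat).
Hypothesis N1 : (1 <= N)%N.
Local Notation leb := (@lebesgue_measure R).
Local Notation al := (N%:R / 2 - 1 / 2 : R).

Definition bessel_integrand (r t : R) : R :=
  (1 + t / 2) `^ al * expR (- (r * t)) * t `^ al.

Definition bessel_integral (r : R) : R :=
  \int[leb]_(t in `]0, +oo[) bessel_integrand r t.

Definition kernel (r : R) : R := log_kernel N r / r ^+ N.

(** This uses N >= 1. A nonnegative exponent makes both powers in the Bessel integrand
    nondecreasing, on which the lower bounds rely. *)
Let al0 : 0 <= al.
Proof. have h : 1 <= N%:R :> R by rewrite ler1n.
lra. Qed.

Let alN : al <= N%:R.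
Proof. by have : 0 <= N%:R :> R by []; lra. Qed.

(** Both powers are at most (1 + t)^N because al <= N; taking K > 2N/d makes the rate 2N/K of their
    product at most d. *)
Let bounds (d : R) : 0 < d -> exists2 M : R, 0 < M & forall t, 0 < t ->
  (1 + t / 2) `^ al * t `^ al <= M * expR (d * t).
Proof.
move=> d0; pose K := (Num.trunc (2 * N%:R / d)).+1.
have K0 : 0 < K%:R :> R by rewrite ltr0n.
exists (K%:R ^+ (2 * N)); first by rewrite exprn_gt0.
move=> t t0.
have h s : 0 < s -> s <= 1 + t -> s `^ al <= (1 + t) ^+ N.
  move=> s0 st; apply: (@le_trans _ _ ((1 + t) `^ al)).
    by apply: ge0_ler_powR => //; rewrite nnegrE; lra.
  rewrite -powR_mulrn; last lra.
  by apply: ler_powR => //; lra.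
apply: (@le_trans _ _ ((1 + t) ^+ N * (1 + t) ^+ N)).
  by apply: ler_pM; rewrite ?powR_ge0//; apply: h; lra.
rewrite -exprD addnn -mul2n.
apply: le_trans (exp_ler1D_expR (2 * N) (ltn0Sn _ : 0 < K)%N (ltW t0)) _.
apply: ler_wpM2l; first by rewrite exprn_ge0.
rewrite ler_expR ler_pM2r// natrM ler_pdivrMr//.
have := truncnS_gt (2 * N%:R / d); rewrite -/K ltr_pdivrMr// => h2.
by rewrite (mulrC d) ltW.
Qed.

Lemma bessel_integrand_ge0 r t : 0 <= bessel_integrand r t.
Proof. by rewrite !mulr_ge0 ?powR_ge0 ?expR_ge0. Qed.

Lemma measurable_bessel_integrand r : measurable_fun [set: R] (bessel_integrand r).
Proof.
apply: measurable_funM; last exact: measurable_powR.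
apply: measurable_funM.
  apply: (measurableT_comp (measurable_powR _)).
  by apply: measurable_funD => //; exact: measurable_funM.
apply: (measurableT_comp (@measurable_expR R)).
by apply: measurableT_comp => //; exact: measurable_funM.
Qed.

Lemma integrable_bessel_integrand r : 0 < r ->
  leb.-integrable `]0, +oo[ (EFin \o bessel_integrand r).
Proof.
move=> r0; have [M M0 HM] := @bounds (r / 2) (divr_gt0 r0 (ltr0Sn _ 1)).
apply: (@integrable_exp_bound _ _ M (r / 2)) => [||t t0].
- exact: measurable_bessel_integrand.
- by rewrite divr_gt0.
rewrite bessel_integrand_ge0/= /bessel_integrand mulrAC.
have -> : expR (- (r / 2 * t)) = expR (r / 2 * t) * expR (- (r * t)).
  by rewrite -expRD; congr expR; lra.
by rewrite mulrA ler_wpM2r ?expR_ge0//; exact: HM.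
Qed.

Lemma bessel_integral_lb r a b c : 0 < r -> 0 < a -> a <= b -> 0 <= c ->
  (forall t, a <= t <= b -> c <= bessel_integrand r t) ->
  c * (b - a) <= bessel_integral r.
Proof.
move=> r0 a0 ab c0 h; apply: Rintegral_itv_lb => //.
- exact: measurable_bessel_integrand.
- exact: integrable_bessel_integrand.
- by move=> t _; exact: bessel_integrand_ge0.
Qed.

Lemma bessel_integral_gt0 r : 0 < r -> 0 < bessel_integral r.
Proof.
move=> r0; apply: (@lt_le_trans _ _ (expR (- (r * 2)) * (2 - 1))).
  by rewrite mulr_gt0 ?expR_gt0//; lra.
apply: bessel_integral_lb; rewrite ?expR_ge0//; first lra.
move=> t /andP[t1 t2]; rewrite /bessel_integrand -[leLHS]mul1r -[leLHS]mulr1.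
have pow1 s : 1 <= s -> 1 <= s `^ al.
  by move=> s1; rewrite -[leLHS](powRr0 s) ler_powR.
apply: ler_pM; rewrite ?mulr_ge0 ?expR_ge0 ?ler01//; last exact: pow1.
apply: ler_pM; rewrite ?expR_ge0 ?ler01//; first by apply: pow1; lra.
by rewrite ler_expR lerN2 ler_pM2l.
Qed.

Lemma bessel_integral_noninc r s : 0 < r -> r <= s ->
  bessel_integral s <= bessel_integral r.
Proof.
move=> r0 rs; apply: le_Rintegral => //.
- by apply: integrable_bessel_integrand; exact: lt_le_trans rs.
- exact: integrable_bessel_integrand.
move=> t /=; rewrite in_itv/= andbT => t0.
rewrite /bessel_integrand ler_wpM2r ?powR_ge0// ler_wpM2l ?powR_ge0//.
by rewrite ler_expR lerN2 ler_pM2r.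
Qed.

Lemma Gamma_gt0 : 0 < Gamma (N%:R / 2 + 1 / 2 : R).
Proof.
have GE : (fun t : R => t `^ (N%:R / 2 + 1 / 2 - 1) * expR (- t)) =
          (fun t : R => t `^ al * expR (- t)).
  by apply/funext => t; congr (_ `^ _ * _); lra.
rewrite /Gamma GE.
have mf : measurable_fun [set: R] (fun t : R => t `^ al * expR (- t)).
  apply: measurable_funM; first exact: measurable_powR.
  by apply: (measurableT_comp (@measurable_expR R)).
have [M M0 HM] := @bounds (1 / 2) (divr_gt0 ltr01 (ltr0Sn _ 1)).
have fint : leb.-integrable `]0, +oo[ (EFin \o (fun t : R => t `^ al * expR (- t))).
  apply: (@integrable_exp_bound _ _ M (1 / 2)) => //.
  move=> t t0; rewrite mulr_ge0 ?powR_ge0 ?expR_ge0//=.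
  have -> : expR (- (1 / 2 * t)) = expR (1 / 2 * t) * expR (- t).
    by rewrite -expRD; congr expR; lra.
  rewrite mulrA ler_wpM2r ?expR_ge0//; apply: le_trans (HM t t0).
  rewrite ler_peMl ?powR_ge0// -[leLHS](powRr0 (1 + t / 2)) ler_powR//; lra.
apply: (@lt_le_trans _ _ (expR (- 2) * (2 - 1))).
  by rewrite mulr_gt0 ?expR_gt0//; lra.
apply: Rintegral_itv_lb => //; rewrite ?expR_ge0 ?ler1n//.
  by move=> t _; rewrite mulr_ge0 ?powR_ge0 ?expR_ge0.
move=> t /andP[t1 t2]; rewrite -[leLHS]mul1r.
apply: ler_pM; rewrite ?expR_ge0 ?ler01//.
  by rewrite -[leLHS](powRr0 t) ler_powR.
by rewrite ler_expR lerN2.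
Qed.

Definition kernel_const : R :=
  2 `^ (1 - N%:R / 2) * (pi / 2) `^ (1 / 2) / Gamma (N%:R / 2 + 1 / 2).

Let C0 : 0 < kernel_const.
Proof.
rewrite divr_gt0 ?Gamma_gt0// mulr_gt0 ?powR_gt0//.
by rewrite divr_gt0// pi_gt0.
Qed.

(** The factor r^(N/2) of [log_kernel] and the one in [besselK] together cancel r^N. In this product
    the exponential carries the decay at infinity and strict monotonicity, the Bessel integral the
    singularity at 0. *)
Lemma kernelE r : 0 < r -> kernel r = kernel_const * (expR (- r) * bessel_integral r).
Proof.
move=> r0; rewrite /kernel /log_kernel /besselK -/(bessel_integral r).
have rN : r `^ (N%:R / 2) * r `^ (N%:R / 2) = r ^+ N.
  rewrite -powRD; last by rewrite (gt_eqF r0) implybT.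
  by rewrite (_ : N%:R / 2 + N%:R / 2 = N%:R) ?powR_mulrn ?ltW//; lra.
rewrite /kernel_const -rN; have := powR_gt0 (N%:R / 2) r0; have := Gamma_gt0.
rewrite /bessel_integral /bessel_integrand.
set G := Gamma _; set I := Rintegral _ _ _; set P := r `^ _ => G0 P0.
by field; rewrite !gt_eqF.
Qed.

Lemma kernel_gt0 r : 0 < r -> 0 < kernel r.
Proof.
move=> r0; rewrite kernelE//; apply: mulr_gt0 => //.
by apply: mulr_gt0; rewrite ?expR_gt0 ?bessel_integral_gt0.
Qed.

Lemma kernel_decr r s : 0 < r -> r < s -> kernel s < kernel r.
Proof.
move=> r0 rs; have s0 := lt_trans r0 rs; rewrite !kernelE// ltr_pM2l//.
apply: (@lt_le_trans _ _ (expR (- r) * bessel_integral s)).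
  by rewrite ltr_pM2r ?bessel_integral_gt0// ltr_expR ltrN2.
by rewrite ler_pM2l ?expR_gt0// bessel_integral_noninc// ltW.
Qed.

Lemma kernel_noninc r s : 0 < r -> r <= s -> kernel s <= kernel r.
Proof.
by move=> r0; rewrite le_eqVlt => /predU1P[->//|rs]; exact/ltW/kernel_decr.
Qed.

Lemma kernel_le_exp eps : 0 < eps -> exists2 M, 0 < M &
  forall r, eps <= r -> kernel r <= M * expR (- r).
Proof.
move=> e0; exists (kernel_const * bessel_integral eps); first by rewrite mulr_gt0 ?bessel_integral_gt0.
move=> r er; rewrite kernelE; last exact: lt_le_trans er.
rewrite -(mulrA kernel_const) ler_pM2l// mulrC.
by rewrite ler_pM2r ?expR_gt0// bessel_integral_noninc.
Qed.

(** With s = 1/r, the Bessel integral is restricted to [s, 2s]: there e^(-rt) >= e^(-2), the powers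
    are at least (s/2)^al and s^al, and the length s completes s^(2 al + 1) = s^N. *)
Lemma kernel_lb : exists2 c, 0 < c & forall r, 0 < r -> r <= 1 -> c / r ^+ N <= kernel r.
Proof.
exists (kernel_const * (expR (- 1) * (expR (- 2) * (1 / 2) `^ al))).
  by apply: mulr_gt0 => //; rewrite mulr_gt0 ?expR_gt0.
move=> r r0 r1; rewrite kernelE// -(mulrA kernel_const) ler_pM2l// -!mulrA.
have r0' := ltW r0; pose s := r^-1; have s0 : 0 < s by rewrite invr_gt0.
have rs : r * s = 1 by rewrite mulfV ?gt_eqF.
have sN : s `^ al * s `^ al * s = s ^+ N.
  rewrite -powRD; last by rewrite (gt_eqF s0) implybT.
  rewrite -[X in _ * X]powRr1 ?ltW// -powRD; last by rewrite (gt_eqF s0) implybT.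
  by rewrite (_ : al + al + 1 = N%:R) ?powR_mulrn ?ltW//; lra.
apply: ler_pM; rewrite ?expR_ge0 ?mulr_ge0 ?expR_ge0 ?powR_ge0 ?invr_ge0 ?exprn_ge0//.
  by rewrite ler_expR lerN2.
have -> : expR (- 2) * ((1 / 2) `^ al / r ^+ N) =
    ((1 / 2) `^ al * s `^ al * expR (- 2) * s `^ al) * (2 * s - s).
  by rewrite -exprVn -/s -sN; ring.
apply: bessel_integral_lb => //; rewrite ?mulr_ge0 ?powR_ge0 ?expR_ge0//; first lra.
move=> t /andP[st ts]; have s0' := ltW s0; rewrite -powRM//.
rewrite /bessel_integrand; apply: ler_pM; rewrite ?mulr_ge0 ?powR_ge0 ?expR_ge0//; last first.
  by apply: ge0_ler_powR => //; rewrite nnegrE; lra.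
apply: ler_pM; rewrite ?powR_ge0 ?expR_ge0//.
  by apply: ge0_ler_powR => //; rewrite ?nnegrE; lra.
rewrite ler_expR lerN2 (_ : 2 = r * (2 * s)); last by rewrite mulrCA rs mulr1.
by rewrite ler_pM2l.
Qed.

End kernel.

(** * The truncated operator as an integral over the whole space *)

Section truncated_operator.
Context {R : realType} (N : nat).
Hypothesis N1 : (1 <= N)%N.
Local Notation mu := (lebesgue_rV R N).
Implicit Types (x y z : 'rV[R]_N) (eps : R) (u : 'rV[R]_N -> R).

(** Extension by 0 replaces the domain of integration, which depends on the centre, by the whole
    space, on which reflections act. *)
Definition kernel_trunc eps z : R := if eps < enorm z then kernel N (enorm z) else 0.

Lemma kernel_trunc_ge0 eps z : 0 < eps -> 0 <= kernel_trunc eps z.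
Proof.
move=> e0; rewrite /kernel_trunc; case: ifP => // ez.
by apply/ltW/kernel_gt0 => //; exact: lt_trans ez.
Qed.

Lemma kernel_truncN eps z : kernel_trunc eps (- z) = kernel_trunc eps z.
Proof. by rewrite /kernel_trunc enormN. Qed.

Lemma measurable_kernel_trunc eps : 0 < eps ->
  measurable_fun [set: 'rV[R]_N] (kernel_trunc eps).
Proof.
move=> e0.
(* Measurability comes from monotonicity, which holds only for positive radii; the maximum with eps
   extends it to the whole line without changing the values used. *)
rewrite (_ : kernel_trunc eps = fun z => if eps < enorm z
    then kernel N (Num.max (enorm z) eps) else 0); last first.
  apply/funext => z; rewrite /kernel_trunc; case: ifP => // ez.
  by rewrite max_l// ltW.
apply: measurable_fun_ifT => //.
  by apply: measurable_fun_ltr => //; exact: measurable_enorm.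
have mk : measurable_fun [set: R] (fun r => kernel N (Num.max r eps)).
  apply: nonincreasing_measurable => // r s rs.
  apply: kernel_noninc => //; first by rewrite lt_max e0 orbT.
  by rewrite ge_max !le_max rs lexx !orbT.
by apply: (measurableT_comp mk); exact: measurable_enorm.
Qed.

Lemma measurable_kernel_trunc_shift eps x : 0 < eps ->
  measurable_fun [set: 'rV[R]_N] (fun y => kernel_trunc eps (x - y)).
Proof.
move=> e0; apply: (measurableT_comp (measurable_kernel_trunc e0)).
exact: measurable_subrV.
Qed.

Lemma integrable_kernel_trunc eps x : 0 < eps ->
  mu.-integrable setT (EFin \o (fun y => kernel_trunc eps (x - y))).
Proof.
move=> e0; have mk := measurable_kernel_trunc_shift x e0.
apply/integrableP; split; first exact/measurable_EFinP.
under eq_integral do rewrite /= ger0_norm ?kernel_trunc_ge0//.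
rewrite -(@ge0_integral_rV_shift _ _ x); last 2 first.
- exact/measurable_EFinP.
- by move=> y; rewrite lee_fin kernel_trunc_ge0.
have [M M0 HM] := @kernel_le_exp R N N1 eps e0.
apply: (@le_lt_trans _ _ (\int[mu]_z (M * expR (- enorm z))%:E)%E).
  apply: ge0_le_integral => //.
  - by move=> z _; rewrite lee_fin kernel_trunc_ge0.
  - apply/measurable_EFinP.
    by apply: (measurableT_comp mk); exact: measurable_addrV.
  - apply/measurable_EFinP; apply: measurable_funM => //.
    apply: (measurableT_comp (@measurable_expR R)).
    by apply: measurableT_comp => //; exact: measurable_enorm.
  - move=> z _; rewrite lee_fin (_ : x - (z + x) = - z); last by rewrite opprD addrCA subrr addr0.
    rewrite kernel_truncN /kernel_trunc; case: ifP => [/ltW/HM//|_].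
    by rewrite mulr_ge0 ?expR_ge0// ltW.
under eq_integral do rewrite EFinM.
rewrite ge0_integralZl//=.
- by rewrite lte_mul_pinfty ?lee_fin ?ltW//; exact: integral_expRN_enorm.
- apply/measurable_EFinP; apply: (measurableT_comp (@measurable_expR R)).
  by apply: measurableT_comp => //; exact: measurable_enorm.
- by rewrite lee_fin ltW.
Qed.

Lemma integrable_bounded_kernel_trunc eps x (v : 'rV[R]_N -> R) M : 0 < eps ->
  measurable_fun setT v -> (forall y, `|v y| <= M) ->
  mu.-integrable setT (EFin \o (fun y => v y * kernel_trunc eps (x - y))).
Proof.
move=> e0 mv vM.
have M0 : 0 <= M by exact: le_trans (normr_ge0 _) (vM 0).
have iK := integrableZl measurableT M (integrable_kernel_trunc x e0).
apply: le_integrable iK => //.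
  apply/measurable_EFinP; apply: measurable_funM => //.
  exact: measurable_kernel_trunc_shift.
move=> y _; rewrite /= lee_fin !normrM (ger0_norm M0).
by rewrite ler_wpM2r.
Qed.

Lemma log_schrodinger_truncE u x eps : measurable_fun setT u -> 0 < eps ->
  log_schrodinger_trunc u x eps =
  (\int[mu]_y ((u x - u y) * kernel_trunc eps (x - y))%:E)%E.
Proof.
move=> mu_ e0; rewrite /log_schrodinger_trunc integral_mkcond.
apply: eq_integral => y _; rewrite patchE /kernel_trunc.
case: (boolP (eps < enorm (x - y))) => h.
  by rewrite mem_set// /kernel mulrA mulrAC.
by rewrite memNset/= ?mulr0//; exact/negP.
Qed.

Lemma integral_refl e l (f : 'rV[R]_N -> \bar R) : dot e e = 1 ->
  measurable_fun setT f ->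
  (\int[mu]_x f (refl e l x) = \int[mu]_x f x)%E.
Proof.
move=> e1 mf; rewrite [LHS]integralE [RHS]integralE.
rewrite -(ge0_integral_refl e1 l (measurable_funepos mf))//.
rewrite -(ge0_integral_refl e1 l (measurable_funeneg mf))//.
by congr (_ - _)%E; apply: eq_integral => x _; rewrite ?funeposE ?funenegE.
Qed.

End truncated_operator.

(** * The reflected comparison inequality *)

Section reflected_comparison.
Context {R : realType} (N : nat).
Hypothesis N1 : (1 <= N)%N.
Local Notation mu := (lebesgue_rV R N).
Variables (u : 'rV[R]_N -> R) (K : R).
Hypotheses (mu_ : measurable_fun setT u) (uK : forall x, 0 <= u x <= K).
Variables (e : 'rV[R]_N) (l : R) (x0 : 'rV[R]_N).
Hypotheses (e1 : dot e e = 1) (x0l : dot x0 e < l).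
Local Notation T := (refl e l).
Let w y := u (T y) - u y.
Let J (z : 'rV[R]_N) := kernel N (enorm z).
Let d := l - dot x0 e.
Hypotheses (w0 : w x0 <= 0) (wmin : forall y, dot y e <= l -> w x0 <= w y).

Let d0 : 0 < d. Proof. by rewrite subr_gt0. Qed.

Let wT y : w (T y) = - w y.
Proof. by rewrite /w (reflK e1) opprB. Qed.

Let wK y : `|w y| <= K.
Proof.
have /andP[a1 a2] := uK y; have /andP[b1 b2] := uK (T y).
by rewrite ler_norml /w; apply/andP; split; lra.
Qed.

Let mw : measurable_fun setT w.
Proof.
apply: measurable_funB => //.
by apply: (measurableT_comp mu_); exact: measurable_refl.
Qed.

Let d_le z : l <= dot z e -> d <= enorm (x0 - z).
Proof.
move=> lz; have := dot_norm_le (x0 - z) e.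
rewrite [enorm e]enormE e1 sqrtr1 mulr1; apply: le_trans.
rewrite -normrN -dotNl opprB dotDl dotNl (le_trans _ (ler_norm _))//.
by rewrite /d lerB.
Qed.

Let D eps : \bar R :=
  (log_schrodinger_trunc u (T x0) eps - log_schrodinger_trunc u x0 eps)%E.

Section fixed_eps.
Variables (rho eps : R) (f : 'rV[R]_N -> R).
Hypotheses (e0 : 0 < eps) (eps_rho : eps <= rho).
Hypotheses (f0 : forall y, 0 <= f y) (mf : measurable_fun setT f).
(** The bound in [fle] is exactly - [G y] when neither kernel is truncated, and the support
    condition with eps <= rho guarantees that case wherever f is nonzero. Stating it without eps
    lets one [f] serve every truncation. *)
Hypothesis fsupp : forall y, f y != 0 -> l < dot y e /\ rho < enorm (x0 - T y).
Hypothesis fle : forall y, l < dot y e -> rho < enorm (x0 - T y) ->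
  f y <= (w (T y) - w x0) * (J (x0 - T y) - J (x0 - y)) - 2 * w x0 * J (x0 - y).

Let k (z : 'rV[R]_N) := kernel_trunc eps z.
Let F y := (w x0 - w y) * k (x0 - y).
Let G y := F y + F (T y).
Let near (x y : 'rV[R]_N) : R := \1_(eball eps) (x - y).
Let err y : R := K * kernel N d * (near x0 y + near (T x0) y).

Let Jd0 : 0 <= kernel N d.
Proof. exact/ltW/kernel_gt0. Qed.

Let K0 : 0 <= K.
Proof. by have /andP[] := uK 0; apply: le_trans. Qed.

Let near0 x y : 0 <= near x y. Proof. by rewrite /near indicE. Qed.

Let nearE x y : enorm (x - y) <= eps -> near x y = 1.
Proof. by move=> h; rewrite /near indicE mem_set. Qed.

Let nearT x y : near x (T y) = near (T x) y.
Proof.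
rewrite /near !indicE; congr (_ %:R); congr nat_of_bool.
by apply/idP/idP; rewrite !inE /eball/= (enorm_refl_swap e1).
Qed.

(* The two kernels, at a point z on the side of x0 and at its mirror image,
   compare favourably except when z is within eps of x0. *)
Let half z : dot z e <= l ->
  (w x0 - w z) * k (x0 - z) + (w x0 + w z) * k (x0 - T z) <=
  K * kernel N d * near x0 z.
Proof.
move=> zl; have wz := wmin zl.
have far := refl_farther e1 (ltW x0l) zl.
have [h|ez] := leP (enorm (x0 - z)) eps.
  rewrite nearE// mulr1 {1}/k /kernel_trunc ltNge h/= mulr0 add0r.
  apply: (@le_trans _ _ (K * k (x0 - T z))).
    rewrite ler_wpM2r ?kernel_trunc_ge0//.
    have := wK z; rewrite ler_norml => /andP[_] wzK.
    by rewrite -[leRHS]add0r lerD.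
  rewrite ler_wpM2l// /k /kernel_trunc; case: ifP => // _.
  by apply: kernel_noninc => //; apply: d_le; rewrite dot_refl//; lra.
apply: (@le_trans _ _ 0); last by apply: mulr_ge0 => //; exact: mulr_ge0.
rewrite /k /kernel_trunc ez (lt_le_trans ez far).
have x0z : 0 < enorm (x0 - z) by exact: lt_trans ez.
have B0 : 0 <= kernel N (enorm (x0 - T z)) by apply/ltW/kernel_gt0 => //; exact: lt_le_trans far.
have BA := kernel_noninc N1 x0z far.
rewrite (_ : _ + _ = (w x0 - w z) * (kernel N (enorm (x0 - z)) - kernel N (enorm (x0 - T z)))
  + 2 * (w x0 * kernel N (enorm (x0 - T z)))); last by ring.
rewrite -[leRHS]addr0 lerD//; first by rewrite mulr_le0_ge0 ?subr_le0 ?subr_ge0.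
by rewrite pmulr_rle0// mulr_le0_ge0.
Qed.

(** [G] is invariant under [T], so beyond the hyperplane [half] applies to T y. Where f is nonzero,
    [fle] says that f + G <= 0. *)
Let G_le y : f y + G y <= err y.
Proof.
have GE : G y = (w x0 - w y) * k (x0 - y) + (w x0 + w y) * k (x0 - T y).
  by rewrite /G /F wT opprK.
have errl : K * kernel N d * near x0 y <= err y.
  by apply: ler_wpM2l; [exact: mulr_ge0|rewrite lerDl].
have errr : K * kernel N d * near x0 (T y) <= err y.
  by rewrite nearT; apply: ler_wpM2l; [exact: mulr_ge0|rewrite lerDr].
have [yl|ly] := leP (dot y e) l.
  have -> : f y = 0 by apply/eqP/negPn/negP => /fsupp[]; rewrite ltNge yl.
  by rewrite add0r GE (le_trans (half yl)).
have Tyl : dot (T y) e <= l by rewrite dot_refl//; lra.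
have GE' : G y = (w x0 - w (T y)) * k (x0 - T y) + (w x0 + w (T y)) * k (x0 - T (T y)).
  by rewrite GE (reflK e1) wT opprK addrC.
have [fy|/fsupp[_ ry]] := eqVneq (f y) 0.
  by rewrite fy add0r GE' (le_trans (half Tyl)).
have := fle ly ry.
have ery : eps < enorm (x0 - T y) by exact: le_lt_trans ry.
have far := refl_farther e1 (ltW x0l) Tyl; rewrite (reflK e1) in far.
have err0 : 0 <= err y by apply: mulr_ge0; [exact: mulr_ge0|exact: addr_ge0].
move: GE'; rewrite /k /kernel_trunc (reflK e1) ery (lt_le_trans ery far) -!/(J _) => ->.
move=> fJ; apply: le_trans err0.
by clearbody w J; lra.
Qed.

Let iF : mu.-integrable setT (EFin \o F).
Proof.
apply: (@integrable_bounded_kernel_trunc _ _ N1 eps x0 (fun y => w x0 - w y) (K + K)) => //.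
  exact: measurable_funB.
by move=> y; rewrite (le_trans (ler_normB _ _))// lerD.
Qed.

Let mF : measurable_fun setT F.
Proof. by have /measurable_int /measurable_EFinP := iF. Qed.

Let iFT : mu.-integrable setT (EFin \o (F \o T)).
Proof.
apply/integrableP; split.
  by apply/measurable_EFinP; apply: (measurableT_comp mF); exact: measurable_refl.
have /integrableP[_] := iF; apply: le_lt_trans.
rewrite -(integral_refl l e1 (f := fun y => `|(F y)%:E|%E))//.
by apply: measurableT_comp => //; exact/measurable_EFinP.
Qed.

(** Reflecting the variable of the first integral gives both the same kernel centred at [x0]; the
    differences of u then combine into w x0 - w y. *)
Let truncF : (log_schrodinger_trunc u (T x0) eps - log_schrodinger_trunc u x0 eps =
  \int[mu]_y (F y)%:E)%E.
Proof.
rewrite !log_schrodinger_truncE//.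
have mk x : measurable_fun setT (fun y : 'rV[R]_N => k (x - y)).
  exact: measurable_kernel_trunc_shift.
have muT : measurable_fun setT (u \o T).
  by apply: (measurableT_comp mu_); exact: measurable_refl.
rewrite -(integral_refl l e1 (f := fun y => ((u (T x0) - u y) * k (T x0 - y))%:E)); last first.
  by apply/measurable_EFinP; apply: measurable_funM => //; exact: measurable_funB.
have kT y : k (T x0 - T y) = k (x0 - y) by rewrite /k /kernel_trunc (enorm_reflB e1).
under eq_integral do rewrite kT.
have bnd a b : `|u a - u b| <= K.
  have /andP[a1 a2] := uK a; have /andP[b1 b2] := uK b.
  by rewrite ler_norml; apply/andP; split; lra.
have i1 : mu.-integrable setT (EFin \o (fun y => (u (T x0) - u (T y)) * k (x0 - y))).
  apply: (@integrable_bounded_kernel_trunc _ _ N1 eps x0 (fun y => u (T x0) - u (T y)) K) => //.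
  exact: measurable_funB.
have i0 : mu.-integrable setT (EFin \o (fun y => (u x0 - u y) * k (x0 - y))).
  apply: (@integrable_bounded_kernel_trunc _ _ N1 eps x0 (fun y => u x0 - u y) K) => //.
  exact: measurable_funB.
rewrite -(integralB measurableT i1 i0); apply: eq_integral => y _ /=.
by rewrite -EFinB; congr EFin; rewrite /F /w; ring.
Qed.

Let mnear x : measurable_fun setT (near x).
Proof.
have mi : measurable_fun setT (\1_(@eball R N eps) : 'rV[R]_N -> R).
  by apply: measurable_indic; exact: measurable_eball.
exact: (measurableT_comp mi (@measurable_subrV R N x)).
Qed.

Let near_le x : (\int[mu]_y (near x y)%:E <= ((2 * eps) ^+ N)%:E)%E.
Proof.
have <- : (\int[mu]_y (\1_(cube x eps) y)%:E = ((2 * eps) ^+ N)%:E)%E.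
  rewrite integral_indic ?setIT//; last exact: measurable_cube.
  by apply: lebesgue_cube; exact: ltW.
apply: ge0_le_integral => //.
- by move=> y _; rewrite lee_fin.
- exact/measurable_EFinP.
- by apply/measurable_EFinP; apply: measurable_indic; exact: measurable_cube.
move=> y _; rewrite lee_fin /near !indicE.
case: (boolP (x - y \in _)) => //; rewrite inE => xy.
rewrite mem_set// => i.
by have := le_trans (coord_le_enorm (x - y) i) xy; rewrite !mxE distrC.
Qed.

Let inear x : mu.-integrable setT (EFin \o near x).
Proof.
apply/integrableP; split; first exact/measurable_EFinP.
under eq_integral do rewrite /= ger0_norm//.
by apply: le_lt_trans (near_le x) _; rewrite ltry.
Qed.

Let ierr : mu.-integrable setT (EFin \o err).
Proof.
have := integrableZl measurableT (K * kernel N d)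
  (integrableD measurableT (inear x0) (inear (T x0))).
by congr (_.-integrable _ _); apply/funext => y /=; rewrite -EFinD -EFinM.
Qed.

Let iG : mu.-integrable setT (EFin \o G).
Proof.
have := integrableD measurableT iF iFT.
by congr (_.-integrable _ _); apply/funext => y /=; rewrite -EFinD.
Qed.

(** [F] and [F] o [T] have the same integral, so [G] integrates to twice [D eps]; each eps-ball in
    [err] lies in a cube of side 2 eps. *)
Lemma reflected_comparison_eps :
  (\int[mu]_y (f y)%:E + (D eps + D eps) <= (K * kernel N d * (2 * (2 * eps) ^+ N))%:E)%E.
Proof.
(* Integrability of f is not assumed but follows from 0 <= f <= err - G. *)
have if_ : mu.-integrable setT (EFin \o f).
  apply: (le_integrable measurableT _ _ (integrableB measurableT ierr iG)).
    exact/measurable_EFinP.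
  move=> y _ /=; rewrite lee_fin ger0_norm//.
  by rewrite (le_trans _ (ler_norm _))// lerBrDr.
have -> : (D eps + D eps = \int[mu]_y (G y)%:E)%E.
  under [RHS]eq_integral do rewrite /G EFinD.
  rewrite (integralD measurableT iF iFT) /D truncF.
  have mEF : measurable_fun setT (EFin \o F) by exact/measurable_EFinP.
  by congr (_ + _)%E; exact/esym/(integral_refl l e1 mEF).
rewrite -(integralD measurableT if_ iG).
apply: (@le_trans _ _ (\int[mu]_y (err y)%:E)%E).
  apply: le_integral => //; first exact: integrableD.
  by move=> y _ /=; rewrite -EFinD lee_fin.
under eq_integral do rewrite /err EFinM EFinD.
rewrite (integralZl measurableT (integrableD measurableT (inear x0) (inear (T x0))))/=.
rewrite (integralD measurableT (inear x0) (inear (T x0))) [leRHS]EFinM.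
apply: lee_wpmul2l; first by rewrite lee_fin mulr_ge0.
rewrite mulr_natl mulr2n EFinD; apply: leeD; exact: near_le.
Qed.

End fixed_eps.

(** The error of the fixed-eps inequality tends to 0 while [D eps] tends to l1 - l0. The factor 2
    comes from the symmetrisation. *)
Lemma reflected_comparison (rho l0 l1 : R) (f : 'rV[R]_N -> R) : 0 < rho ->
  (forall y, 0 <= f y) -> measurable_fun setT f ->
  (forall y, f y != 0 -> l < dot y e /\ rho < enorm (x0 - T y)) ->
  (forall y, l < dot y e -> rho < enorm (x0 - T y) ->
    f y <= (u y - u (T y) - (u (T x0) - u x0)) *
           (kernel N (enorm (x0 - T y)) - kernel N (enorm (x0 - y)))
         - 2 * (u (T x0) - u x0) * kernel N (enorm (x0 - y))) ->
  (log_schrodinger_trunc u x0 eps @[eps --> 0^'+] --> l0%:E)%E ->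
  (log_schrodinger_trunc u (T x0) eps @[eps --> 0^'+] --> l1%:E)%E ->
  (\int[mu]_y (f y)%:E <= (2 * (l0 - l1))%:E)%E.
Proof.
move=> rho0 f0 mf fsupp fle c0 c1.
have key eps : 0 < eps -> eps <= rho ->
    (\int[mu]_y (f y)%:E + (D eps + D eps) <= (K * kernel N d * (2 * (2 * eps) ^+ N))%:E)%E.
  move=> e0 er; apply: (@reflected_comparison_eps rho) => // y ly ry.
  by have := fle y ly ry; rewrite {1 2}/w (reflK e1).
have /fine_cvgP[fin0 cf0] := c0; have /fine_cvgP[fin1 cf1] := c1.
pose h eps := K * kernel N d * (2 * (2 * eps) ^+ N) -
  2 * (fine (log_schrodinger_trunc u (T x0) eps) - fine (log_schrodinger_trunc u x0 eps)).
have hc : h eps @[eps --> 0^'+] --> 2 * (l0 - l1).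
  (* N >= 1 is needed here: 0 to the power 0 is 1, so for N = 0 the error would not vanish. *)
  rewrite (_ : 2 * (l0 - l1) = K * kernel N d * (2 * (2 * 0) ^+ N) - 2 * (l1 - l0)); last first.
    by rewrite mulr0 expr0n eqn0Ngt N1 !mulr0 sub0r; ring.
  apply: cvgB; last by apply: cvgMr; exact: cvgB.
  apply: cvgMr; apply: cvgMr.
  apply: cvg_at_right_filter; elim: N => [|n ih]; first exact: cvg_cst.
  under eq_fun do rewrite exprS; rewrite exprS; apply: cvgM => //.
  by apply: cvgMr; exact: cvg_id.
have near_le : \forall eps \near 0^'+, (\int[mu]_y (f y)%:E <= (h eps)%:E)%E.
  have p1 : \forall eps \near 0^'+, 0 < eps :> R by exact: nbhs_right_gt.
  have p2 : \forall eps \near 0^'+, eps <= rho by exact: nbhs_right_le.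
  apply: (filterS _ (filterI (filterI p1 p2) (filterI fin0 fin1))).
  move=> eps [[e0 er] [F0 F1]].
  have := key eps e0 er; rewrite /D.
  rewrite -(fineK F0) -(fineK F1) -EFinB -EFinD -leeBrDr// -EFinB.
  by rewrite /h [2 * (_ - _)]mulr_natl mulr2n.
have : (\int[mu]_y (f y)%:E)%E \is a fin_num.
  have [eps heps] := @filter_ex _ _ _ _ near_le.
  rewrite ge0_fin_numE; first by apply: le_lt_trans heps _; rewrite ltry.
  by apply: integral_ge0 => y _; rewrite lee_fin.
move=> ffin; rewrite -(fineK ffin) lee_fin.
apply: (ler_cvg_to (cvg_cst _) hc).
by apply: (filterS _ near_le) => eps; rewrite -lee_fin fineK.
Qed.

End reflected_comparison.

(** * Divergence of the kernel integral on half-spaces *)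

Section half_space_kernel.
Context {R : realType} (N : nat).
Hypothesis N1 : (1 <= N)%N.
Local Notation mu := (lebesgue_rV R N).
Implicit Types (x y e : 'rV[R]_N) (s t : R).

(** For a unit vector e, the half-space condition already forces |x - y| > s/2, so the truncation
    changes no value; it supplies measurability and nonnegativity. *)
Definition half_space_kernel e x s y : R :=
  if s / 2 < dot (y - x) e then kernel_trunc (s / 2) (x - y) else 0.

Lemma half_space_kernel_ge0 e x s y : 0 < s -> 0 <= half_space_kernel e x s y.
Proof.
by move=> s0; rewrite /half_space_kernel; case: ifP => // _; rewrite kernel_trunc_ge0 ?divr_gt0.
Qed.

Lemma measurable_half_space_kernel e x s : 0 < s ->
  measurable_fun setT (half_space_kernel e x s).
Proof.
move=> s0; apply: measurable_fun_ifT => //.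
  apply: measurable_fun_ltr => //; apply: (measurableT_comp (measurable_dot e)).
  exact: measurable_addrV.
by apply: measurable_kernel_trunc_shift => //; rewrite divr_gt0.
Qed.

Lemma dot_le_dist e x y : dot e e = 1 -> dot (y - x) e <= enorm (x - y).
Proof.
by move=> e1; have := dot_le_enorm (y - x) e; rewrite [enorm e]enormE e1 sqrtr1 mulr1 enormB.
Qed.

Lemma half_space_kernelE e x s y : dot e e = 1 -> s / 2 < dot (y - x) e ->
  half_space_kernel e x s y = kernel N (enorm (x - y)).
Proof.
move=> e1 h; rewrite /half_space_kernel h /kernel_trunc.
by rewrite (lt_le_trans h) ?dot_le_dist.
Qed.

(* Each scale t contributes the same amount, through a cube of size
   proportional to t centred at x + t e: this is the divergence of r^-N at 0. *)
Lemma integral_half_space_kernel_step : exists2 k : R, 0 < k &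
  forall e x t, dot e e = 1 -> 0 < t -> 2 * t <= 1 ->
  (\int[mu]_y (half_space_kernel e x (4 * t) y)%:E + k%:E <=
   \int[mu]_y (half_space_kernel e x t y)%:E)%E.
Proof.
have [c c0 hc] := @kernel_lb R N N1.
have N0 : 0 < N%:R :> R by rewrite ltr0n.
exists (c * (4 * N%:R)^-1 ^+ N).
  by rewrite mulr_gt0// exprn_gt0// invr_gt0 mulr_gt0.
move=> e x t e1 t0 t1.
have t40 : 0 < 4 * t by rewrite mulr_gt0.
(* This half-side puts the cube inside the ball of radius t/4 about x + t e. There (y - x).e is
   above t/2 and below 2t, so the cube is seen at scale t but not at scale 4t, and |x - y| <= 2t. *)
pose r := t / (4 * N%:R).
have r0 : 0 < r by rewrite divr_gt0// mulr_gt0.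
pose C : set 'rV[R]_N := cube (x + t *: e) r.
have mC : measurable_fun setT (\1_C : 'rV[R]_N -> R).
  by apply: measurable_indic; exact: measurable_cube.
have volC : (\int[mu]_y (c / (2 * t) ^+ N * \1_C y)%:E = (c * (4 * N%:R)^-1 ^+ N)%:E)%E.
  under eq_integral do rewrite EFinM.
  rewrite ge0_integralZl//; last 2 first.
  - exact/measurable_EFinP.
  - by rewrite lee_fin divr_ge0 ?exprn_ge0 ?mulr_ge0 ?ltW.
  rewrite integral_indic ?setIT//; last exact: measurable_cube.
  rewrite [X in (_ * X)%E](_ : _ = ((2 * r) ^+ N)%:E); last by apply: lebesgue_cube; exact: ltW.
  rewrite -EFinM; congr EFin; rewrite -mulrA; congr (c * _).
  rewrite -exprVn -exprMn; congr (_ ^+ _); rewrite /r.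
  by field; rewrite !gt_eqF.
rewrite -volC -ge0_integralD//=.
- apply: ge0_le_integral => //.
  + move=> y _; rewrite adde_ge0// lee_fin ?half_space_kernel_ge0//.
    by rewrite mulr_ge0// divr_ge0 ?exprn_ge0 ?mulr_ge0 ?ltW.
  + apply: emeasurable_funD; apply/measurable_EFinP.
      exact: measurable_half_space_kernel.
    exact: measurable_funM.
  + by apply/measurable_EFinP; exact: measurable_half_space_kernel.
  move=> y _; rewrite -EFinD lee_fin indicE.
  case: (boolP (y \in C)) => [/set_mem yC|_]; last first.
    rewrite mulr0 addr0.
    have [h|h] := ltP (4 * t / 2) (dot (y - x) e); last first.
      by rewrite {1}/half_space_kernel ltNge h/= half_space_kernel_ge0.
    by rewrite !half_space_kernelE//; lra.
  have yt : enorm (y - x - t *: e) <= t / 4.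
    rewrite (_ : t / 4 = N%:R * r); last by rewrite /r; field; rewrite gt_eqF.
    by apply: enorm_le_coord => i; have := yC i; rewrite !mxE opprD addrA.
  have : `|dot (y - x - t *: e) e| <= t / 4.
    by have := dot_norm_le (y - x - t *: e) e; rewrite [enorm e]enormE e1 sqrtr1 mulr1 => /le_trans; apply.
  rewrite dotDl dotNl dotZl e1 mulr1 ler_norml => /andP[h1 h2].
  have ny : enorm (x - y) <= 2 * t.
    have := enormD (y - x - t *: e) (t *: e).
    rewrite subrK enormZ [enorm e]enormE e1 sqrtr1 mulr1 (ger0_norm (ltW t0)) enormB; lra.
  have xy : t / 2 < dot (y - x) e by lra.
  have pxy : 0 < enorm (x - y) by apply: (lt_le_trans _ (dot_le_dist x y e1)); lra.
  rewrite {1}/half_space_kernel ifF ?add0r ?mulr1; last first.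
    by apply/negbTE; rewrite -leNgt; lra.
  rewrite half_space_kernelE//; apply: le_trans (hc _ pxy _); last by lra.
  rewrite ler_pM2l// lef_pV2 ?posrE ?exprn_gt0// ?mulr_gt0//.
  by rewrite lerXn2r// nnegrE ?mulr_ge0// ltW.
- by move=> y _; rewrite lee_fin half_space_kernel_ge0.
- by apply/measurable_EFinP; exact: measurable_half_space_kernel.
- by move=> y _; rewrite lee_fin mulr_ge0// divr_ge0 ?exprn_ge0 ?mulr_ge0 ?ltW.
- by apply/measurable_EFinP; exact: measurable_funM.
Qed.

(** Each division of the scale by 4 adds the fixed amount k, so more than Q/k divisions suffice, for
    all e and x at once. *)
Lemma integral_half_space_kernel_unbounded (Q : R) : exists2 s : R, 0 < s &
  forall e x, dot e e = 1 -> (Q%:E < \int[mu]_y (half_space_kernel e x s y)%:E)%E.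
Proof.
have [k k0 hk] := integral_half_space_kernel_step.
pose s n : R := 2^-1 * 4^-1 ^+ n.
have s0 n : 0 < s n by rewrite mulr_gt0// exprn_gt0.
have s1 n : 2 * s n <= 1.
  rewrite /s mulrA divff// mul1r exprn_ile1//; lra.
have sS n : s n = 4 * s n.+1 by rewrite /s exprS; field.
have lb n e x : dot e e = 1 ->
    ((n%:R * k)%:E <= \int[mu]_y (half_space_kernel e x (s n) y)%:E)%E.
  move=> e1; elim: n => [|n ih].
    by rewrite mul0r; apply: integral_ge0 => y _; rewrite lee_fin half_space_kernel_ge0.
  apply: le_trans (hk e x (s n.+1) e1 (s0 _) (s1 _)).
  by rewrite -sS -natr1 mulrDl mul1r EFinD leeD2r.
exists (s (Num.trunc (Q / k)).+1) => // e x e1.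
apply: lt_le_trans (lb _ e x e1); rewrite lte_fin -ltr_pdivrMr//.
exact: truncnS_gt.
Qed.

End half_space_kernel.

(** The convexity inequality at b, obtained without derivatives from Young's inequality for c and
    b^(p-1) with exponents p and p/(p-1). *)
Lemma powR_tangent (R : realType) (p b c : R) : 1 < p -> 0 <= b -> 0 <= c ->
  b `^ p - c `^ p <= p * b `^ (p - 1) * (b - c).
Proof.
move=> p1 b0 c0; have p0 : 0 < p by lra.
have p10 : 0 < p - 1 by lra.
have := @conjugate_powR R c (b `^ (p - 1)) p (p / (p - 1)) c0 (powR_ge0 _ _) p0.
rewrite divr_gt0// -powRrM mulrCA divff ?mulr1; last by rewrite gt_eqF.
have -> : p^-1 + (p / (p - 1))^-1 = 1 by field; rewrite !gt_eqF.
move=> /(_ isT erefl).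
have bb : b `^ (p - 1) * b = b `^ p by rewrite mulrC mulr_powRB1.
have -> : b `^ p / (p / (p - 1)) = b `^ p * (p - 1) / p by field; rewrite !gt_eqF.
rewrite -mulrDl ler_pdivlMr//.
have -> : p * b `^ (p - 1) * (b - c) = p * (b `^ (p - 1) * b) - c * b `^ (p - 1) * p by ring.
rewrite bb; lra.
Qed.

(** * Consequences of the equation at negative minima *)

Section solution.
Context {R : realType} (N : nat).
Hypothesis N1 : (1 <= N)%N.
Local Notation mu := (lebesgue_rV R N).
Variables (m p K : R) (u : 'rV[R]_N -> R).
Hypotheses (m0 : 0 < m) (p1 : 1 < p).
Hypotheses (mu_ : measurable_fun setT u) (uK : forall x, 0 <= u x <= K).
Hypothesis sol : log_schrodinger_solution m p u.
Implicit Types (e x y : 'rV[R]_N) (l : R).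

Let p0 : 0 < p. Proof. exact: lt_trans p1. Qed.

Let q0 : 0 < p - 1. Proof. by rewrite subr_gt0. Qed.

Let cN : R := log_const N.

Let cN0 : 0 < cN. Proof. by rewrite powR_gt0// pi_gt0. Qed.

Let phi (b : R) := (b `^ p - m * b) / cN.

(** The equation holds in the extended reals and its right-hand side is finite, which excludes an
    infinite principal value; solving for the limit gives [phi (u x)]. *)
Let solution_cvg x :
  (log_schrodinger_trunc u x eps @[eps --> 0^'+] --> (phi (u x))%:E)%E.
Proof.
have [c] := sol x; rewrite /log_schrodinger.
move: (c); rewrite /(cvg _); case: (lim _) => [r| |] /= cL; last 2 first.
- by rewrite gt0_muley ?lte_fin//= addye.
- by rewrite gt0_muleNy ?lte_fin//= addNye.
rewrite -EFinM -EFinD => -[h].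
have <- : r = phi (u x) by rewrite /phi -h addrK mulrAC mulfV ?gt_eqF// mul1r.
exact: cL.
Qed.

Let comparison e l x rho (f : 'rV[R]_N -> R) : dot e e = 1 -> dot x e < l ->
  u (refl e l x) <= u x ->
  (forall y, dot y e <= l -> u (refl e l x) - u x <= u (refl e l y) - u y) ->
  0 < rho -> (forall y, 0 <= f y) -> measurable_fun setT f ->
  (forall y, f y != 0 -> l < dot y e /\ rho < enorm (x - refl e l y)) ->
  (forall y, l < dot y e -> rho < enorm (x - refl e l y) ->
    f y <= (u y - u (refl e l y) - (u (refl e l x) - u x)) *
           (kernel N (enorm (x - refl e l y)) - kernel N (enorm (x - y)))
         - 2 * (u (refl e l x) - u x) * kernel N (enorm (x - y))) ->
  (\int[mu]_y (f y)%:E <= (2 * (phi (u x) - phi (u (refl e l x))))%:E)%E.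
Proof.
move=> e1 xl w0 wmin rho0 f0 mf fs fle.
apply: (@reflected_comparison R N N1 u K mu_ uK e l x e1 xl _ wmin rho) => //.
by rewrite subr_le0.
Qed.

Definition negative_min e l x := [/\ dot x e < l, u (refl e l x) < u x &
  forall y, dot y e <= l -> u (refl e l x) - u x <= u (refl e l y) - u y].

Let phi_le b c : 0 <= b -> 0 <= c -> c <= b ->
  phi b - phi c <= (p * b `^ (p - 1) - m) / cN * (b - c).
Proof.
move=> b0 c0 cb; rewrite /phi -mulrBl [leRHS]mulrAC ler_pM2r ?invr_gt0//.
have := powR_tangent p1 b0 c0; lra.
Qed.

(** The zero test function gives phi(u x) >= phi(u(T x)), whereas the tangent inequality bounds this
    difference by (p (u x)^(p-1) - m)/cN times a positive number; hence p (u x)^(p-1) >= m. *)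
Lemma negative_min_large e l x : dot e e = 1 -> negative_min e l x ->
  (m / p) `^ (1 / (p - 1)) <= u x.
Proof.
move=> e1 [xl w0 wmin].
have [/andP[b0 _] /andP[c0 _]] := (uK x, uK (refl e l x)).
have := @comparison e l x 1 (fun=> 0) e1 xl (ltW w0) wmin ltr01.
have far y : l < dot y e -> enorm (x - refl e l y) <= enorm (x - y).
  move=> yl; have := @refl_farther _ _ e e1 l x (refl e l y) (ltW xl).
  by rewrite (reflK e1); apply; rewrite dot_refl//; lra.
move=> /(_ (fun=> lexx _) (measurable_cst _)) H.
have {H} : (\int[mu]_(y in setT) 0%:E <= (2 * (phi (u x) - phi (u (refl e l x))))%:E)%E.
  apply: H => [y|y yl ry]; first by rewrite eqxx.
  have ny : 0 < enorm (x - refl e l y) by apply: lt_trans ry.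
  have A := kernel_noninc N1 ny (far y yl).
  have B := kernel_gt0 N1 (lt_le_trans ny (far y yl)).
  have Tyl : dot (refl e l y) e <= l by rewrite dot_refl//; lra.
  have := wmin _ Tyl; rewrite (reflK e1) => C.
  apply: addr_ge0; first by rewrite mulr_ge0 ?subr_ge0.
  by rewrite oppr_ge0 pmulr_lle0// pmulr_rle0// subr_le0 ltW.
rewrite integral0 lee_fin => H.
have {}H : 0 <= (p * u x `^ (p - 1) - m) / cN * (u x - u (refl e l x)).
  by apply: le_trans (phi_le b0 c0 (ltW w0)); rewrite -(@pmulr_rge0 _ 2).
rewrite pmulr_lge0 ?subr_gt0// pmulr_lge0 ?invr_gt0// subr_ge0 in H.
rewrite -(@powRr1 _ (u x))//.
have -> : u x `^ 1 = (u x `^ (p - 1)) `^ (1 / (p - 1)).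
  by rewrite -powRrM mulrCA divff ?mulr1// gt_eqF.
apply: ge0_ler_powR; rewrite ?nnegrE ?powR_ge0 ?divr_ge0 ?ler01//; try exact: ltW.
by rewrite ler_pdivrMr// mulrC.
Qed.

(** With W = - w x > 0, the term - 2 w x J(x - y) of the comparison dominates 2W times the
    half-space kernel. If x were too close to the hyperplane, the integral of the latter would
    exceed 2WQ, while the right-hand side is at most 2WQ by the tangent inequality and u <= K. *)
Lemma negative_min_far : exists2 d : R, 0 < d &
  forall e l x, dot e e = 1 -> negative_min e l x -> d <= l - dot x e.
Proof.
pose Q := p * K `^ (p - 1) / cN.
have [s s0 hs] := integral_half_space_kernel_unbounded N1 Q.
(* With rho = l - x.e < s/16, a point y with (y - x).e > s/2 lies beyond the hyperplane, and |x - T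
   y| >= (y - x).e - 2 rho > rho, as the comparison requires. *)
exists (s / 16); first by rewrite divr_gt0.
move=> e l x e1 [xl w0 wmin]; rewrite leNgt; apply/negP => ds.
have [/andP[b0 bK] /andP[c0 _]] := (uK x, uK (refl e l x)).
pose W := u x - u (refl e l x); have W0 : 0 < W by rewrite subr_gt0.
pose f y := 2 * W * half_space_kernel e x s y.
have mh := @measurable_half_space_kernel R N N1 e x s s0.
pose rho := l - dot x e; have rho0 : 0 < rho by rewrite subr_gt0.
have hpos y : f y != 0 -> s / 2 < dot (y - x) e.
  by rewrite /f /half_space_kernel; case: ifP => //; rewrite mulr0 eqxx.
have far y : l < dot y e -> enorm (x - refl e l y) <= enorm (x - y).
  move=> yl; have := @refl_farther _ _ e e1 l x (refl e l y) (ltW xl).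
  by rewrite (reflK e1); apply; rewrite dot_refl//; lra.
have := @comparison e l x rho f e1 xl (ltW w0) wmin rho0.
have f0 y : 0 <= f y by rewrite mulr_ge0 ?half_space_kernel_ge0// mulr_ge0// ltW.
have mf : measurable_fun setT f by exact: measurable_funM.
move=> /(_ f0 mf) H.
have {}H : (\int[mu]_y (f y)%:E <= (2 * (phi (u x) - phi (u (refl e l x))))%:E)%E.
  apply: H => [y /hpos|y yl ry].
    rewrite dotDl dotNl => h; split; first lra.
    rewrite enormB (enorm_refl_swap e1).
    have := dot_le_dist (refl e l x) y e1; rewrite enormB dotDl dotNl dot_refl//.
    by rewrite /rho; lra.
  have ny : 0 < enorm (x - refl e l y) by apply: lt_trans ry.
  have A := kernel_noninc N1 ny (far y yl).
  have B := kernel_gt0 N1 (lt_le_trans ny (far y yl)).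
  have Tyl : dot (refl e l y) e <= l by rewrite dot_refl//; lra.
  have := wmin _ Tyl; rewrite (reflK e1) => C.
  apply: (@le_trans _ _ (2 * W * kernel N (enorm (x - y)))).
    rewrite /f ler_pM2l ?mulr_gt0//.
    have [h|h] := ltP (s / 2) (dot (y - x) e); first by rewrite half_space_kernelE.
    by rewrite /half_space_kernel ltNge h/= ltW.
  rewrite -subr_ge0 /W.
  have : 0 <= (u y - u (refl e l y) - (u (refl e l x) - u x)) *
           (kernel N (enorm (x - refl e l y)) - kernel N (enorm (x - y))).
    by rewrite mulr_ge0 ?subr_ge0.
  by lra.
move: H; under eq_integral do rewrite /f EFinM.
rewrite ge0_integralZl//; last 3 first.
- exact/measurable_EFinP.
- by move=> y _; rewrite lee_fin half_space_kernel_ge0.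
- by rewrite lee_fin mulr_ge0// ltW.
move=> H.
have W20 : 0 < 2 * W by rewrite mulr_gt0.
have {H} : ((2 * W)%:E * Q%:E < (2 * (phi (u x) - phi (u (refl e l x))))%:E)%E.
  by apply: lt_le_trans H; rewrite lte_pmul2l ?lte_fin// hs.
rewrite -EFinM lte_fin; apply/negP; rewrite -leNgt -mulrA ler_pM2l//.
apply: le_trans (phi_le b0 c0 (ltW w0)) _.
rewrite mulrC ler_pM2l// ler_pM2r ?invr_gt0//.
apply: (@le_trans _ _ (p * u x `^ (p - 1))); first by rewrite gerBl ltW.
rewrite ler_pM2l//.
by apply: ge0_ler_powR; rewrite ?nnegrE ?(le_trans b0 bK)//; exact: ltW.
Qed.

(** A zero of w is a minimum with equal values of [phi], so every admissible test function has
    integral at most 0. If w y > 0, continuity allows a positive multiple of the indicator of a cube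
    around T y, a contradiction. *)
Lemma reflection_strong_max e l x : dot e e = 1 ->
  (forall y (eps : R), 0 < eps -> exists2 d : R, 0 < d &
     forall z, enorm (z - y) <= d -> `|u z - u y| < eps) ->
  (forall y, dot y e <= l -> u y <= u (refl e l y)) ->
  dot x e < l -> u (refl e l x) = u x ->
  forall y, dot y e < l -> u (refl e l y) = u y.
Proof.
move=> e1 ucont wge0 xl wx y yl; apply/eqP; rewrite eq_le (wge0 y (ltW yl)) andbT leNgt.
apply/negP => wy.
pose W := u (refl e l y) - u y; have W0 : 0 < W by rewrite subr_gt0.
have N0 : 0 < N%:R :> R by rewrite ltr0n.
have [d1 d10 hd1] := ucont (refl e l y) (W / 4) (divr_gt0 W0 (ltr0Sn _ 3)).
have [d2 d20 hd2] := ucont y (W / 4) (divr_gt0 W0 (ltr0Sn _ 3)).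
pose r1 := enorm (x - y); pose r2 := enorm (x - refl e l y).
have r12 : r1 < r2 by exact: refl_farther_lt.
have r10 : 0 < r1.
  rewrite lt0r enorm_ge0 andbT enorm_eq0 subr_eq0; apply/eqP => xy.
  by move: wy; rewrite -xy wx ltxx.
(* The first two radii keep the difference of u above W/2, the bound r1/4 keeps mirror points
   farther than r1/2 from x, (r2 - r1)/4 keeps r1 + d < r2 - d so the kernels compare strictly, and
   the last keeps the cube beyond the hyperplane. *)
pose d := Num.min (Num.min d1 d2) (Num.min (Num.min (r1 / 4) ((r2 - r1) / 4)) ((l - dot y e) / 2)).
have d0 : 0 < d by rewrite !lt_min d10 d20 !divr_gt0 ?subr_gt0.
have := lexx d; rewrite {2}/d !le_min => /andP[/andP[dd1 dd2] /andP[/andP[dr1 dr12] dl]].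
pose rho := r1 / 2; have rho0 : 0 < rho by rewrite divr_gt0.
pose C : set 'rV[R]_N := cube (refl e l y) (d / N%:R).
have dN0 : 0 < d / N%:R by rewrite divr_gt0.
pose c := W / 2 * (kernel N (r1 + d) - kernel N (r2 - d)).
have c0 : 0 < c.
  by rewrite mulr_gt0 ?divr_gt0// subr_gt0; apply: kernel_decr => //; lra.
pose f z := c * \1_C z.
have mf : measurable_fun setT f.
  by apply: measurable_funM => //; apply: measurable_indic; exact: measurable_cube.
have f0 z : 0 <= f z by rewrite /f indicE mulr_ge0// ltW.
have inC z : C z -> enorm (z - refl e l y) <= d.
  move=> Cz; rewrite (_ : d = N%:R * (d / N%:R)); last by field; rewrite gt_eqF.
  by apply: enorm_le_coord => i; have := Cz i; rewrite !mxE.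
have Cfacts z : C z -> [/\ l < dot z e, rho < enorm (x - refl e l z),
    enorm (x - refl e l z) <= r1 + d, r2 - d <= enorm (x - z) & W / 2 <= u z - u (refl e l z)].
  move=> /inC zd.
  have zd' : enorm (refl e l z - y) <= d by rewrite (enorm_refl_swap e1).
  split.
  - have := dot_norm_le (z - refl e l y) e.
    rewrite [enorm e]enormE e1 sqrtr1 mulr1 ler_norml dotDl dotNl dot_refl// => /andP[h _]; lra.
  - have := enorm_dist (x - y) (refl e l z - y); rewrite opprB addrA subrK -/r1 /rho; lra.
  - have := enormD (x - y) (y - refl e l z); rewrite addrA subrK -/r1 (enormB y); lra.
  - have := enorm_dist (x - refl e l y) (z - refl e l y); rewrite opprB addrA subrK -/r2; lra.
  have := hd1 z (le_trans zd dd1); have := hd2 _ (le_trans zd' dd2).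
  rewrite !ltr_norml /W => /andP[a1 a2] /andP[a3 a4]; lra.
have := @comparison e l x rho f e1 xl.
rewrite wx subrr lexx => /(_ isT) H.
have {H} : (\int[mu]_z (f z)%:E <= (2 * (phi (u x) - phi (u x)))%:E)%E.
  apply: H => // [z zl|z|z zl rz].
  - by rewrite subr_ge0 wge0.
  - rewrite /f indicE; case: (boolP (z \in C)) => [/set_mem/Cfacts[]//|_].
    by rewrite mulr0 eqxx.
  rewrite subr0 mulr0 mul0r subr0.
  have Tzl : dot (refl e l z) e <= l by rewrite dot_refl//; lra.
  have wz : 0 <= u z - u (refl e l z).
    by have := wge0 _ Tzl; rewrite (reflK e1) subr_ge0.
  have ny : 0 < enorm (x - refl e l z) by apply: lt_trans rz.
  have far : enorm (x - refl e l z) <= enorm (x - z).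
    by have := refl_farther e1 (ltW xl) Tzl; rewrite (reflK e1).
  have A := kernel_noninc N1 ny far.
  rewrite /f indicE; case: (boolP (z \in C)) => [/set_mem/Cfacts[_ _ z1 z2 z3]|_]; last first.
    by rewrite mulr0 mulr_ge0// subr_ge0.
  rewrite mulr1 /c; apply: ler_pM => //.
  - by rewrite divr_ge0// ltW.
  - by rewrite subr_ge0; apply: kernel_noninc => //; lra.
  apply: lerB; apply: kernel_noninc => //; lra.
rewrite subrr mulr0; under eq_integral do rewrite /f EFinM.
rewrite ge0_integralZl//; last 2 first.
- by apply/measurable_EFinP; apply: measurable_indic; exact: measurable_cube.
- by rewrite lee_fin ltW.
rewrite integral_indic ?setIT//; last exact: measurable_cube.
rewrite [X in (_ * X)%E](_ : _ = ((2 * (d / N%:R)) ^+ N)%:E); last by apply: lebesgue_cube; exact: ltW.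
rewrite -EFinM lee_fin; apply/negP; rewrite -ltNge.
by rewrite mulr_gt0// exprn_gt0// mulr_gt0.
Qed.

End solution.

(** * Continuity *)

Section dini_continuity.
Context {R : realType}.
Local Notation leb := (@lebesgue_measure R).

(** Monotonicity read off from the supremum over simple functions. It applies to the modulus of
    continuity without a proof that the latter is measurable. *)
Lemma ge0_le_integral_nomeasurable d (T : measurableType d)
    (mu : {measure set T -> \bar R}) (D : set T) (f g : T -> \bar R) :
  (forall x, D x -> (0 <= f x)%E) -> (forall x, D x -> (f x <= g x)%E) ->
  (\int[mu]_(x in D) f x <= \int[mu]_(x in D) g x)%E.
Proof.
move=> f0 fg; rewrite !ge0_integralE//; last first.
  by move=> x Dx; exact: le_trans (f0 _ Dx) (fg _ Dx).
apply: le_ereal_sup => _ /= [h hf <-]; exists h => // x.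
apply: le_trans (hf x) _; rewrite !patchE; case: ifPn => // /set_mem; exact: fg.
Qed.

Lemma integral_inv_pinfty (g : R -> \bar R) (c : R) : 0 < c ->
  (forall r, 0 < r < 1 -> ((c / r)%:E <= g r)%E) ->
  (\int[leb]_(r in `]0%R, 1%R[) g r = +oo)%E.
Proof.
move=> c0 cg.
pose s n : R := 2^-1 ^+ n.
have s0 n : 0 < s n by rewrite exprn_gt0.
have s1 n : s n <= 1 by rewrite exprn_ile1//; lra.
have sK n : 2 ^+ n * s n = 1 by rewrite -exprMn mulfV// expr1n.
pose A n : set R := `]0, s n.+1[%classic.
pose S n r : R := \sum_(j < n) 2 ^+ j * \1_(A j) r.
have S0 n r : 0 <= S n r by apply: sumr_ge0 => j _; rewrite mulr_ge0// exprn_ge0.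
(* On ]0, 1[ the staircase S n stays below 1/r, while its integral is n/2. *)
have SV n r : 0 < r -> S n r <= 2 ^+ n - 1 /\ S n r <= r^-1.
  move=> r0; elim: n => [|n [ih1 ih2]].
    by rewrite /S big_ord0 expr0 subrr; split => //; rewrite invr_ge0 ltW.
  rewrite /S big_ord_recr/= -/(S n r) indicE; case: (boolP (r \in A n)) => [/set_mem|_].
    rewrite /A/= in_itv/= => /andP[_ rs]; rewrite mulr1.
    have h : S n r + 2 ^+ n <= 2 ^+ n.+1 - 1 by rewrite exprS; lra.
    split => //; apply: (le_trans h); apply: (@le_trans _ _ (2 ^+ n.+1)); first lra.
    rewrite -[leRHS]mul1r ler_pdivlMr// -[leRHS](sK n.+1) ler_pM2l ?exprn_gt0//.
    exact: ltW.
  rewrite mulr0 addr0; split => //; rewrite (le_trans ih1)// exprS.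
  have h : 0 <= 2 ^+ n :> R by rewrite exprn_ge0.
  lra.
apply/eqyP => M M0.
pose n := (Num.trunc (M * 2 / c)).+1.
have mA j : measurable (A j) by exact: measurable_itv.
have IS : (\int[leb]_r (c * S n r)%:E = (c * (n%:R / 2))%:E)%E.
  under eq_integral do rewrite EFinM.
  have mI j : measurable_fun [set: R] (\1_(A j) : R -> R) by exact: measurable_indic.
  have mT j : measurable_fun [set: R] (fun r => 2 ^+ j * \1_(A j) r : R).
    exact: measurable_funM.
  have mS : measurable_fun [set: R] (S n) by exact: measurable_sum.
  rewrite ge0_integralZl//; last 3 first.
  - exact/measurable_EFinP.
  - by move=> r _; rewrite lee_fin.
  - by rewrite lee_fin ltW.
  rewrite EFinM; congr (_ * _)%E; rewrite /S.
  under eq_integral do rewrite -sumEFin.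
  rewrite ge0_integral_sum//; last first.
  - by move=> j; apply/measurable_EFinP; exact: mT.
  rewrite (eq_bigr (fun=> (2^-1)%:E)) => [|j _].
    by rewrite sumEFin sumr_const card_ord mulr_natl.
  under eq_integral do rewrite EFinM.
  rewrite ge0_integralZl//; last by apply/measurable_EFinP; exact: mI.
  have -> : (\int[leb]_r (\1_(A j) r)%:E = (s j.+1)%:E)%E.
    have As : lebesgue_measure (A j) = (s j.+1)%:E.
      by rewrite /A lebesgue_measure_itv/= lte_fin s0 sube0.
    by rewrite integral_indic ?setIT//; exact: mA.
  by rewrite -EFinM; congr EFin; rewrite /s exprS mulrCA sK mulr1.
apply: (@le_trans _ _ (c * (n%:R / 2))%:E).
  rewrite lee_fin mulrA ler_pdivlMr// -ler_pdivrMl// mulrC.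
  exact/ltW/truncnS_gt.
rewrite -IS [leRHS]integral_mkcond; apply: ge0_le_integral_nomeasurable => [r _|r _].
  by rewrite lee_fin mulr_ge0// ltW.
rewrite patchE; case: ifPn => [/set_mem|] /=.
  rewrite in_itv/= => r01; apply: le_trans (cg _ r01).
  by rewrite lee_fin ler_pM2l//; case/andP: r01 => /(SV n)[].
rewrite notin_setE/= in_itv/= => r01.
rewrite /S big1 ?mulr0// => j _; rewrite indicE memNset ?mulr0//.
rewrite /A/= in_itv/= => /andP[r0 rs]; apply: r01.
by rewrite r0/= (lt_le_trans rs).
Qed.

(** At a discontinuity the modulus stays above some eps at every radius, and eps/r has infinite
    integral on ]0, 1[. *)
Lemma dini_continuous_within n (u : 'rV[R]_n -> R) x :
  dini_continuous_at setT u x -> forall eps : R, 0 < eps ->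
  exists2 d : R, 0 < d & forall z, enorm (z - x) <= d -> `|u z - u x| < eps.
Proof.
move=> dx eps e0; apply: contrapT => H.
have {}H d : 0 < d -> exists2 z, enorm (z - x) <= d & eps <= `|u z - u x|.
  move=> d0; apply: contrapT => h; apply: H; exists d => // z zd.
  by rewrite ltNge; apply/negP => ez; apply: h; exists z.
move: dx; rewrite /dini_continuous_at (@integral_inv_pinfty _ eps)//.
move=> r /andP[r0 _]; rewrite EFinM; apply: lee_wpmul2r; first by rewrite lee_fin invr_ge0 ltW.
have [z zr ez] := H r r0.
apply: (@le_trans _ _ `|u x - u z|%:E); first by rewrite lee_fin distrC.
by apply: ereal_sup_ubound; exists z => //; split => //; rewrite enormB.
Qed.

End dini_continuity.

(** * Topology and compactness for the Euclidean norm *)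

Section topology_rV.
Context {R : realType} {n : nat}.
Implicit Types (x y e : 'rV[R]_n) (l : R).

Lemma enorm_le_norm x : enorm x <= n%:R * `|x|.
Proof.
apply: enorm_le_coord => i; rewrite [`|x|]mx_normrE.
by apply: (@le_bigmax _ _ _ 0 (fun ij => `|x ij.1 ij.2|) (ord0, i)).
Qed.

Lemma norm_le_enorm x : `|x| <= enorm x.
Proof.
have [->|x0] := eqVneq `|x| 0; first exact: enorm_ge0.
have [[i j] /= xij] := mx_norm_neq0 x0.
rewrite (xij : `|x| = _) (ord1 i).
exact: coord_le_enorm.
Qed.

Lemma continuous_of_enorm (u : 'rV[R]_n -> R) :
  (forall x (eps : R), 0 < eps -> exists2 d : R, 0 < d &
     forall z, enorm (z - x) <= d -> `|u z - u x| < eps) -> continuous u.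
Proof.
move=> hu x; apply/(@cvgrPdist_lt _ R^o _ (nbhs x)) => eps e0; have [d d0 hd] := hu x eps e0.
have : \forall z \near x, ball x (d / n.+1%:R) z.
  by apply: nbhsx_ballx; rewrite divr_gt0.
apply: filterS => z; rewrite -ball_normE /= => zd; rewrite distrC; apply: hd.
rewrite enormB (le_trans (enorm_le_norm _))//.
apply: (@le_trans _ _ (n.+1%:R * `|x - z|)).
  by rewrite ler_wpM2r// ler_nat.
by rewrite mulrC -ler_pdivlMr// ltW.
Qed.

Lemma continuous_dot e : continuous (fun x : 'rV[R]_n => dot x e).
Proof.
apply: continuous_of_enorm => x eps e0.
have c0 : 0 < enorm e + 1 by rewrite ltr_wpDl// enorm_ge0.
exists (eps / 2 / (enorm e + 1)); first by rewrite !divr_gt0.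
move=> z zx; rewrite -dotNl -dotDl (le_lt_trans (dot_norm_le _ _))//.
apply: (@le_lt_trans _ _ (enorm (z - x) * (enorm e + 1))).
  by rewrite ler_wpM2l ?enorm_ge0// lerDl.
rewrite -ltr_pdivlMr//; apply: (le_lt_trans zx).
by rewrite ltr_pM2r ?invr_gt0//; lra.
Qed.

Lemma continuous_enorm : continuous (fun x : 'rV[R]_n => enorm x).
Proof.
apply: continuous_of_enorm => x eps e0; exists (eps / 2); first by rewrite divr_gt0.
move=> z zx; apply: (@le_lt_trans _ _ (enorm (z - x))); last lra.
rewrite ler_norml enorm_dist andbT lerNl opprB enormB; exact: enorm_dist.
Qed.

Lemma closed_half_space e l : closed [set x : 'rV[R]_n | dot x e <= l].
Proof.
apply: (@closed_comp _ _ (fun x => dot x e) [set r | r <= l]); last exact: closed_le.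
by move=> x _; exact: continuous_dot.
Qed.

Lemma compact_eball c : compact (@eball R n c).
Proof.
apply: bounded_closed_compact; last first.
  apply: (@closed_comp _ _ (fun x => enorm x) [set r | r <= c]); last exact: closed_le.
  by move=> x _; exact: continuous_enorm.
exists c; split; first exact: num_real.
move=> M cM x xc; apply: (le_trans (norm_le_enorm x)).
by apply: (le_trans xc); exact: ltW.
Qed.

(** Continuity jointly in the point and the hyperplane, in the form required by the near-covering
    characterisation of compactness. *)
Lemma near_refl (u : 'rV[R]_n -> R) e l x (eps : R) : dot e e = 1 ->
  (forall x (eps : R), 0 < eps -> exists2 d : R, 0 < d &
     forall z, enorm (z - x) <= d -> `|u z - u x| < eps) -> 0 < eps ->
  \forall z \near x & t \near l, `|u (refl e t z) - u (refl e l x)| < eps.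
Proof.
move=> e1 hu e0; have [d d0 hd] := hu (refl e l x) eps e0.
have n0 : 0 < n.+1%:R :> R by rewrite ltr0n.
near=> z t; apply: hd.
have -> : refl e t z - refl e l x = refl e 0 (z - x) + (2 * (t - l)) *: e.
  rewrite /refl opprD addrACA -scalerBl -[RHS]addrA -[in RHS]scalerDl; congr (_ + _ *: _).
  by rewrite dotDl dotNl; ring.
apply: (le_trans (enormD _ _)); rewrite enorm_refl0// enormZ normrM.
rewrite [enorm e]enormE e1 sqrtr1 mulr1 ger0_norm//.
have zx : enorm (z - x) <= d / 2.
  rewrite enormB; apply: (le_trans (enorm_le_norm _)).
  apply: (@le_trans _ _ (n.+1%:R * `|x - z|)); first by rewrite ler_wpM2r// ler_nat.
  rewrite mulrC -ler_pdivlMr// ltW//.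
  have : ball x (d / 2 / n.+1%:R) z.
    by near: z; apply: nbhsx_ballx; rewrite !divr_gt0.
  by rewrite -ball_normE.
have tl : `|t - l| <= d / 4.
  have : ball l (d / 4) t by near: t; apply: nbhsx_ballx; rewrite divr_gt0.
  by rewrite -ball_normE/= distrC => /ltW.
by lra.
Unshelve. all: by end_near. Qed.

Lemma bounded_of_cvg_at_infty (u : 'rV[R]_n -> R) (a : R) : continuous u ->
  cvg_at_infty u a -> exists K : R, forall x, u x <= K.
Proof.
move=> cu ua; have [M hM] := ua 1 ltr01.
have [|||c _ hc] := @compact_EVT_max _ R u (eball (Num.max M 0)).
- by exists 0; rewrite /eball/= enorm0 le_max lexx orbT.
- exact: compact_eball.
- exact: continuous_subspaceT.
exists (Num.max (u c) (a + 1)) => x; rewrite le_max.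
have [xM|xM] := leP (enorm x) (Num.max M 0).
  by rewrite hc// mem_set.
have := hM x; rewrite gt_max in xM; case/andP: xM => xM _ /(_ xM).
by rewrite ltr_norml => /andP[_ h]; apply/orP; right; lra.
Qed.

End topology_rV.

(** * Moving planes *)

Section moving_planes.
Context {R : realType} (N : nat).
Hypothesis N1 : (1 <= N)%N.
Variables (m p a K : R) (u : 'rV[R]_N -> R).
Hypotheses (m0 : 0 < m) (p1 : 1 < p).
Hypotheses (mu_ : measurable_fun setT u) (uK : forall x, 0 <= u x <= K).
Hypothesis ucont : forall x (eps : R), 0 < eps -> exists2 d : R, 0 < d &
  forall z, enorm (z - x) <= d -> `|u z - u x| < eps.
Hypothesis sol : log_schrodinger_solution m p u.
Hypothesis ulim : cvg_at_infty u a.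
Hypothesis a_lt : a < (m / p) `^ (1 / (p - 1)).
Implicit Types (e x y z : 'rV[R]_N) (l t : R).

Definition below_reflection e l := forall y, dot y e <= l -> u y <= u (refl e l y).

Let cu : continuous u. Proof. exact: continuous_of_enorm. Qed.

Let continuous_w e l : dot e e = 1 -> continuous (fun y => u (refl e l y) - u y).
Proof.
move=> e1; apply: continuous_of_enorm => x eps e0.
have e20 : 0 < eps / 2 by rewrite divr_gt0.
have [d1 d10 h1] := ucont (refl e l x) e20.
have [d2 d20 h2] := ucont x e20.
exists (Num.min d1 d2); first by rewrite lt_min d10.
move=> z; rewrite le_min => /andP[z1 z2].
have := h1 (refl e l z); rewrite (enorm_reflB e1) => /(_ z1).
have := h2 z z2; rewrite !ltr_norml => /andP[b1 b2] /andP[b3 b4].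
by apply/andP; split; lra.
Qed.

(** Since u has a limit at infinity, w tends to 0 there, so a negative value forces the minimum to
    be attained on a compact set; it is off the hyperplane, where w = 0. *)
Lemma negative_min_exists e l : dot e e = 1 -> ~ below_reflection e l ->
  exists x, negative_min u e l x.
Proof.
move=> e1 /existsNP[y1 /not_implyP[y1l /negP]]; rewrite -ltNge => y1w.
pose W := u y1 - u (refl e l y1); have W0 : 0 < W by rewrite subr_gt0.
have [M hM] := ulim (divr_gt0 W0 (ltr0Sn R 1)).
(* Outside this ball both y and its mirror image have norm above M, because a reflection lowers the
   norm by at most 2|l|; hence w > - W there. *)
pose C := eball (Num.max (M + 2 * `|l|) (enorm y1)) `&` [set y : 'rV[R]_N | dot y e <= l].
have y1C : C y1 by split => //; rewrite /eball/= le_max lexx orbT.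
have cC : compact C by apply: compact_closedI; [exact: compact_eball|exact: closed_half_space].
have [||x xC xmin] := @compact_EVT_min _ R (fun y => u (refl e l y) - u y) C _ cC.
- by exists y1.
- by apply: continuous_subspaceT; exact: continuous_w.
have [xb xl] := set_mem xC.
have wx : u (refl e l x) - u x <= - W by rewrite /W opprB xmin// mem_set.
exists x; split; last 2 first.
- by rewrite -subr_lt0 (le_lt_trans wx)// oppr_lt0.
- move=> y yl; have [yb|yb] := leP (enorm y) (Num.max (M + 2 * `|l|) (enorm y1)).
    by apply: xmin; rewrite mem_set.
  apply: (le_trans wx); rewrite gt_max in yb; case/andP: yb => yM _.
  have := enorm_refl_ge e1 l y => yr.
  have := normr_ge0 l => l0.
  have y1M : M < enorm y by lra.
  have y2M : M < enorm (refl e l y) by lra.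
  have := hM y y1M; have := hM _ y2M.
  by rewrite !ltr_norml => /andP[b1 b2] /andP[b3 b4]; lra.
rewrite lt_neqAle xl andbT; apply/eqP => xel.
by move: wx; rewrite (refl_fix xel) subrr leNgt oppr_lt0 W0.
Qed.

(** This is where the bound on a acts: far out u is below the threshold that negative minima must
    reach. *)
Let large_bound : exists M0 : R, forall e l x, dot e e = 1 ->
  negative_min u e l x -> enorm x <= M0.
Proof.
have [M hM] : exists M : R, forall x, M < enorm x -> `|u x - a| < (m / p) `^ (1 / (p - 1)) - a.
  by apply: ulim; rewrite subr_gt0.
exists M => e l x e1 /(negative_min_large N1 m0 p1 mu_ uK sol e1) ux.
rewrite leNgt; apply/negP => /hM; rewrite ltr_norml => /andP[_].
by rewrite ltrD2r ltNge ux.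
Qed.

(** A negative minimum would satisfy both x.e < - M0 and |x| <= M0. *)
Let below_reflection_start : exists M0 : R, forall e l, dot e e = 1 -> l <= - M0 ->
  below_reflection e l.
Proof.
have [M0 hM] := large_bound; exists M0 => e l e1 lM; apply: contrapT => /(negative_min_exists e1).
move=> [x xmin]; have := hM e l x e1 xmin; have [xl _ _] := xmin.
have := dot_norm_le x e; rewrite [enorm e]enormE e1 sqrtr1 mulr1 ler_norml => /andP[h _].
by move=> h'; have xM := lt_le_trans xl lM; lra.
Qed.

Let below_reflection_eq e l : dot e e = 1 -> below_reflection e l ->
  below_reflection (- e) (- l) -> forall x, u (refl e l x) = u x.
Proof.
move=> e1 b1 b2 x.
have b2' y : l <= dot y e -> u y <= u (refl e l y).
  by move=> ly; have := b2 y; rewrite dotNr lerN2 reflN => /(_ ly).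
apply/eqP; rewrite eq_le; have [xl|xl] := leP (dot x e) l.
  rewrite b1// andbT; have := b2' (refl e l x); rewrite (reflK e1); apply.
  by rewrite dot_refl//; lra.
rewrite (b2' x (ltW xl)) andbT; have := b1 (refl e l x); rewrite (reflK e1); apply.
by rewrite dot_refl//; lra.
Qed.

Let below_reflection_sup e l : dot e e = 1 ->
  (forall eps : R, 0 < eps -> exists2 t, l - eps < t < l & below_reflection e t) ->
  below_reflection e l.
Proof.
move=> e1 h y; rewrite le_eqVlt => /predU1P[yl|yl]; first by rewrite (refl_fix yl).
rewrite leNgt; apply/negP => uy.
have V0 : 0 < u y - u (refl e l y) by rewrite subr_gt0.
have [d d0 hd] := ucont (refl e l y) V0.
have md : 0 < Num.min (d / 2) (l - dot y e) by rewrite lt_min divr_gt0// subr_gt0.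
have [t /andP[t1 t2] bt] := h _ md.
have tl : l - t < Num.min (d / 2) (l - dot y e) by lra.
move: tl; rewrite lt_min => /andP[td ty].
have yt : dot y e <= t by lra.
have := hd (refl e t y).
have -> : refl e t y - refl e l y = (2 * (t - l)) *: e.
  by rewrite /refl opprD addrACA subrr add0r -scalerBl; congr (_ *: _); ring.
rewrite enormZ [enorm e]enormE e1 sqrtr1 mulr1 normrM ger0_norm// distrC ger0_norm; last lra.
have tld : 2 * (l - t) <= d by lra.
move=> /(_ tld); rewrite ltr_norml => /andP[_].
by rewrite ltrD2r ltNge (bt y yt).
Qed.

Lemma moving_planes e : dot e e = 1 -> exists l,
  (forall x, u (refl e l x) = u x) /\ (forall t, t <= l -> below_reflection e t).
Proof.
move=> e1; have [M0 hM] := below_reflection_start.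
have en1 : dot (- e) (- e) = 1 by rewrite dotNl dotNr opprK.
(* Quantifying over all t <= l makes A downward closed, so every value below its supremum is
   admissible. *)
pose A := [set l | forall t, t <= l -> below_reflection e t].
have AM : A (- M0) by move=> t; exact: hM.
(* If the plane reaches M0, symmetry is immediate: the hyperplane at - M0 for - e is the same one,
   and the starting bound gives the opposite inequality. *)
have [AM'|AM'] := pselect (A M0).
  exists M0; split => //; apply: below_reflection_eq => //; first exact: AM'.
  exact: hM.
have ubA : ubound A M0.
  move=> l Al; rewrite leNgt; apply/negP => Ml; apply: AM' => t tM.
  by apply: Al; exact: le_trans (ltW Ml).
have hsA : has_sup A by split; [exists (- M0)|exists M0].
pose l0 := sup A.
have Alt t : t < l0 -> below_reflection e t.
  move=> tl; have [l Al tl'] := sup_gt (proj1 hsA) tl.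
  exact/Al/ltW.
have Al0 : A l0.
  move=> t; rewrite le_eqVlt => /predU1P[->|]; last exact: Alt.
  apply: below_reflection_sup => // eps e0; exists (l0 - eps / 2); first by lra.
  by apply: Alt; lra.
exists l0; split => //.
have w0 := Al0 l0 (lexx _).
suff heq y : dot y e < l0 -> u (refl e l0 y) = u y.
  move=> x; have [xl|xl] := ltP (dot x e) l0; first exact: heq.
  have := heq (refl e l0 x); rewrite (reflK e1) => h.
  move: xl; rewrite le_eqVlt => /predU1P[xl|xl]; first by rewrite refl_fix.
  by apply/esym/h; rewrite dot_refl//; lra.
have [[x [xl xw]]|nx] := pselect (exists x, dot x e < l0 /\ u (refl e l0 x) = u x).
  exact: (reflection_strong_max N1 mu_ uK sol e1 ucont w0 xl xw).
have wpos x : dot x e < l0 -> 0 < u (refl e l0 x) - u x.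
  move=> xl; rewrite subr_gt0 lt_neqAle w0 ?ltW// andbT; apply/eqP => h.
  by apply: nx; exists x.
have [M1 hM1] := large_bound.
have [d d0 hd] := negative_min_far N1 m0 p1 mu_ uK sol.
(* For every t <= l0 + d/2, a negative minimum lies in this fixed compact set: it is in the ball,
   and x.e <= t - d <= l0 - d/2. Positivity of w on C persists for t near l0, which rules such
   minima out. *)
pose C := eball M1 `&` [set y : 'rV[R]_N | dot y e <= l0 - d / 2].
have cC : compact C by apply: compact_closedI; [exact: compact_eball|exact: closed_half_space].
have : \forall t \near l0, C `<=` (fun x => 0 < u (refl e t x) - u x).
  have nc := (compact_near_coveringP C).1 cC.
  apply: (nc R (nbhs l0) (fun t x => 0 < u (refl e t x) - u x)) => x [_ xl].
  have Wx : 0 < u (refl e l0 x) - u x by apply: wpos; rewrite /= in xl; lra.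
  pose W := (u (refl e l0 x) - u x) / 2; have W0 : 0 < W by rewrite divr_gt0.
  have n1 := near_refl l0 x e1 ucont W0.
  have n2 : \forall z \near x & t \near l0, `|u x - u z| < W.
    have h1 : \forall z \near x, `|u x - u z| < W.
      have /(@cvgrPdist_lt _ R^o _ (nbhs x)) cux := @cu x.
      exact: cux.
    exact: (cvg_fst h1).
  apply: (filterS _ (filterI n1 n2)) => -[z t] [/=].
  rewrite !ltr_norml /W => /andP[b1 b2] /andP[b3 b4]; lra.
move=> /nbhs_ballP[r /= r0 hr].
exfalso.
pose mn := Num.min (r / 2) (d / 2); pose t1 := l0 + mn.
have mn0 : 0 < mn by rewrite lt_min !divr_gt0.
have At1 : A t1.
  move=> t tt1; have [tl|tl] := leP t l0; first exact: Al0.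
  apply: contrapT => /(negative_min_exists e1)[x xmin].
  have xM := hM1 e t x e1 xmin; have xd := hd e t x e1 xmin.
  have /andP[mr md] : (mn <= r / 2) && (mn <= d / 2) by rewrite -le_min.
  have [_ xw _] := xmin.
  have : ball l0 r t by rewrite /ball/= ltr0_norm; rewrite /t1 in tt1; lra.
  move=> /hr /(_ x) h; move: xw; apply/negP; rewrite -leNgt -subr_ge0; apply/ltW/h.
  by split => //=; rewrite /t1 in tt1; lra.
have := ub_le_sup (proj2 hsA) At1; rewrite -/l0 /t1; lra.
Qed.

End moving_planes.

(** * From reflection symmetries to radial monotonicity *)

Section radial_symmetry.
Context {R : realType} (N : nat).
Variables (a : R) (u : 'rV[R]_N -> R).
Hypothesis ulim : cvg_at_infty u a.
Hypothesis planes : forall e, dot e e = 1 -> exists l,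
  (forall x, u (refl e l x) = u x) /\ (forall t, t <= l -> below_reflection u e t).
Implicit Types (e x y z : 'rV[R]_N) (l t : R).

Let basis (i : 'I_N) : 'rV[R]_N := delta_mx ord0 i.

Let dot_basis x i : dot x (basis i) = x ord0 i.
Proof.
rewrite /dot (bigD1 i)//= mxE !eqxx mulr1 big1 ?addr0// => j ji.
by rewrite mxE (negbTE ji) andbF mulr0.
Qed.

Let basis1 i : dot (basis i) (basis i) = 1.
Proof. by rewrite dot_basis mxE !eqxx. Qed.

Let point_symmetry : exists x0, forall x, u (x0 + x0 - x) = u x.
Proof.
have /choice[lam hlam] : forall i : 'I_N, exists l, forall x, u (refl (basis i) l x) = u x.
  by move=> i; have [l [hl _]] := planes (basis1 i); exists l.
exists (\row_i lam i) => x.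
(* [P k] is the image of x under the first k coordinate reflections, and [P N] its image under the
   point symmetry. *)
pose P k : 'rV[R]_N := \row_i (if (i < k)%N then lam i + lam i - x ord0 i else x ord0 i).
have uP k : (k <= N)%N -> u (P k) = u x.
  elim: k => [_|k ih kN].
    by congr u; apply/rowP => i; rewrite mxE.
  rewrite -(ih (ltnW kN)) -(hlam (Ordinal kN) (P k)); congr u.
  apply/rowP => i; rewrite /refl !mxE dot_basis mxE ltnn ltnS eqxx/=.
  have [->|ik] := eqVneq i (Ordinal kN); first by rewrite leqnn ltnn/= mulr1; ring.
  by rewrite mulr0 addr0 leq_eqVlt; move: ik; rewrite -val_eqE/= => /negbTE ->.
rewrite -[RHS](uP N (leqnn N)); congr u.
by apply/rowP => i; rewrite !mxE ltn_ord.
Qed.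

(** The points x + k c e leave every ball while u keeps the value u x on them, so u x is the limit
    a. *)
Let periodic_cst e c : dot e e = 1 -> c != 0 ->
  (forall x, u (x + c *: e) = u x) -> forall x, u x = a.
Proof.
move=> e1 c0 uc x.
have uk k : u (x + (k%:R * c) *: e) = u x.
  elim: k => [|k ih]; first by rewrite mul0r scale0r addr0.
  by rewrite -natr1 mulrDl mul1r scalerDl addrA uc.
apply/eqP; rewrite -subr_eq0 -normr_eq0; apply/negPn/negP => ne.
have d0 : 0 < `|u x - a| by rewrite lt0r ne normr_ge0.
have [M hM] := ulim d0.
pose k := (Num.trunc ((`|M| + enorm x) / `|c|)).+1.
suff hk : M < enorm (x + (k%:R * c) *: e) by have := hM _ hk; rewrite uk ltxx.
have c0' : 0 < `|c| by rewrite normr_gt0.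
have kc : `|M| + enorm x < k%:R * `|c| by rewrite -ltr_pdivrMr// truncnS_gt.
have := enorm_dist ((k%:R * c) *: e) (- x).
rewrite opprK enormN enormZ [enorm e]enormE e1 sqrtr1 mulr1 normrM.
rewrite (ger0_norm (ler0n R k)) (addrC _ x).
by have := ler_norm M; lra.
Qed.

Lemma radial_of_reflections (N1 : (1 <= N)%N) :
  (forall x, 0 <= u x) ->
  exists (x0 : 'rV[R]_N) (g : R -> R),
    [/\ forall r, 0 <= r -> 0 <= g r,
        forall r s, 0 <= r -> r <= s -> g s <= g r &
        forall x, u x = g (enorm (x - x0))].
Proof.
move=> u0; have [x0 sym] := point_symmetry.
have [cst|ncst] := pselect (forall x, u x = a).
  exists 0, (fun=> a); split => // r _; by rewrite -(cst 0).
(* Conjugating the reflection at l by the point symmetry gives the reflection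
   at 2 x0.e - l; unless the two coincide, u is periodic along e. *)
have planes0 e : dot e e = 1 -> (forall x, u (refl e (dot x0 e) x) = u x) /\
    (forall t, t <= dot x0 e -> below_reflection u e t).
  move=> e1; have [l [hl bl]] := planes e1.
  have [<-//|ne] := eqVneq l (dot x0 e).
  exfalso; apply: ncst; apply: (@periodic_cst e (4 * (dot x0 e - l))) => //.
    by rewrite mulf_neq0// subr_eq0 eq_sym.
  move=> x; rewrite -[RHS]hl -[RHS]sym -[RHS]hl -[RHS]sym; congr u.
  rewrite /refl; apply/rowP => i; rewrite !mxE !dotE e1; ring.
have radial x y : enorm (x - x0) = enorm (y - x0) -> u x = u y.
  move=> /(congr1 (fun r => r ^+ 2)); rewrite !sqr_enorm => xy.
  have [->//|ne] := eqVneq x y.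
  pose z := x - y; have z0 : 0 < enorm z by rewrite lt0r enorm_eq0 subr_eq0 ne enorm_ge0.
  (* Two points equidistant from x0 are exchanged by the reflection in the hyperplane through x0
     normal to their difference. *)
  pose e := (enorm z)^-1 *: z.
  have e1 : dot e e = 1.
    by rewrite /e dotZl dotZr -sqr_enorm; field; rewrite gt_eqF.
  rewrite -((planes0 e e1).1 x); congr u; rewrite /refl.
  have h : 2 * (dot x0 z - dot x z) = - enorm z ^+ 2.
    move: xy; rewrite sqr_enorm /z !dotE (dotC x0) (dotC x0) (dotC y x); lra.
  rewrite [in X in X *: _]/e !dotZr -mulrBr mulrCA h /e scalerA.
  rewrite (_ : _ * _ = -1); last by field; rewrite gt_eqF.
  by rewrite scaleN1r /z opprB addrC subrK.
pose e := basis (Ordinal N1); have e1 : dot e e = 1 by exact: basis1.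
have enorm_e r : 0 <= r -> enorm (r *: e) = r.
  by move=> r0; rewrite enormZ [enorm e]enormE e1 sqrtr1 mulr1 ger0_norm.
exists x0, (fun r => u (x0 + r *: e)); split => [r _|r s r0 rs|x]; first exact: u0.
  have s0 : 0 <= s by exact: le_trans rs.
  (* The monotonicity available lies on the side x.e <= x0.e. Once the points are flipped there, the
     reflection at x0.e - (r + s)/2 sends x0 - s e to x0 - r e. *)
  have flip t : u (x0 + t *: e) = u (x0 - t *: e).
    by apply: radial; rewrite addrC addKr [in RHS]addrC addKr enormN.
  rewrite !flip.
  have tl : dot x0 e - (r + s) / 2 <= dot x0 e by lra.
  have yt : dot (x0 - s *: e) e <= dot x0 e - (r + s) / 2 by rewrite !dotE e1; lra.
  have := (planes0 e e1).2 _ tl _ yt; congr (_ <= u _).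
  by apply/rowP => i; rewrite /refl !mxE !dotE e1; field.
by apply: radial; rewrite addrC [x0 + _]addrC addrK enorm_e ?enorm_ge0// addrC.
Qed.

End radial_symmetry.

Theorem theorem1p1 (R : realType) (N : nat) (m p a : R) (u : 'rV[R]_N -> R) :
  (1 <= N)%N -> 0 < m -> 1 < p ->
  L0space u ->
  (forall x, 0 <= u x) ->
  dini_continuous [set: 'rV[R]_N] u ->
  log_schrodinger_solution m p u ->
  cvg_at_infty u a ->
  a < (m / p) `^ (1 / (p - 1)) ->
  exists (x0 : 'rV[R]_N) (g : R -> R),
    [/\ forall r, 0 <= r -> 0 <= g r,
        forall r s, 0 <= r -> r <= s -> g s <= g r &
        forall x, u x = g (enorm (x - x0))].
Proof.
move=> N1 m0 p1 [[mu _] _] u0 dini sol ulim alt.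
have ucont x (eps : R) : 0 < eps -> exists2 d : R, 0 < d &
    forall z, enorm (z - x) <= d -> `|u z - u x| < eps.
  by move=> e0; apply: (dini_continuous_within _ e0); exact: dini.
have [K uK] := bounded_of_cvg_at_infty (continuous_of_enorm ucont) ulim.
apply: (radial_of_reflections ulim _ N1 u0) => e e1.
apply: (moving_planes N1 m0 p1 mu _ ucont sol ulim alt e1) => x.
by rewrite u0; exact: uK.
Qed.
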